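(* There exist absolute constants $C,\bar C>0$ such that the following holds. Let $d_1\le d_2$ be positive integers. Let $\lambda$ and $\mu$ be partitions of $n$ of levels $d_1$ and $d_2$ respectively, and let $\nu$ be a partition of $n$ of arbitrary level. Then $$g(\lambda,\mu,\nu)\le\left(\frac{C^{d_2}d_1^{d_1}d_2^{d_2}}{n^{d_1+d_2}}\chi_\lambda(1)\chi_\mu(1)\right)^{1/2}\le\bar C^{d_2}d_1^{d_1/4}d_2^{d_2/4}.$$
   Context: For a partition $\lambda=(\lambda_1\ge\lambda_2\ge\cdots)$ of $n$, $\chi_\lambda$ is the corresponding irreducible complex character of the symmetric group $S_n$. Write $\lambda'$ for the conjugate partition, so $\lambda_1'$ is the number of parts of $\lambda$. The level of $\lambda$ (equivalently of $\chi_\lambda$) is $\min(n-\lambda_1,\,n-\lambda_1')$. The Kronecker coefficient is $g(\lambda,\mu,\nu)=\frac{1}{n!}\sum_{\sigma\in S_n}\chi_\lambda(\sigma)\chi_\mu(\sigma)\chi_\nu(\sigma)$, i.e. the multiplicity of the Specht module $V_\nu$ in $V_\lambda\otimes V_\mu$. *)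

(* Defs.v *)
From HB Require Import structures.
From mathcomp Require Import all_boot all_order all_algebra.
From mathcomp Require Import all_fingroup all_solvable all_field all_character.

Set Implicit Arguments.
Unset Strict Implicit.
Unset Printing Implicit Defensive.

Import Order.TTheory GRing.Theory Num.Theory.

Definition is_partition (n : nat) (s : seq nat) : bool :=
  [&& sorted geq s, 0 \notin s & sumn s == n].

Record intpart (n : nat) := IntPart {
  parts :> seq nat;
  intpartP : is_partition n parts
}.

(* head 0 lambda is the first part; size lambda is the number of parts, i.e.
   the first part of the conjugate partition. *)
Definition level (n : nat) (lambda : intpart n) : nat :=
  minn (n - head 0 lambda) (n - size lambda).

(* The tableau of shape lambda with entries 0, ..., n-1 in reading order. *)
Definition tab_row (n : nat) (lambda : intpart n) (i : 'I_n) : nat :=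
  reshape_index lambda i.

Definition tab_col (n : nat) (lambda : intpart n) (i : 'I_n) : nat :=
  reshape_offset lambda i.

Definition row_stab (n : nat) (lambda : intpart n) : {set 'S_n} :=
  [set s : 'S_n | [forall i, tab_row lambda (s i) == tab_row lambda i]].

Definition col_stab (n : nat) (lambda : intpart n) : {set 'S_n} :=
  [set s : 'S_n | [forall i, tab_col lambda (s i) == tab_col lambda i]].

Local Open Scope ring_scope.

(* Complex representations are taken over algC, as everywhere in the character
   library. *)
Definition Sym_regular (n : nat) :
    mx_representation algC 'Sym_('I_n) #|'Sym_('I_n)|%g :=
  regular_repr algC 'Sym_('I_n)%G.

(* The Young symmetrizer (sum of the row stabilizer) * (signed sum of the
   column stabilizer), an element of the group algebra in row vector form. *)
Definition young_symmetrizer (n : nat) (lambda : intpart n) :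
    'rV[algC]_#|'Sym_('I_n)|%g :=
  \sum_(p in row_stab lambda) \sum_(q in col_stab lambda)
    (-1) ^+ odd_perm q *: delta_mx 0 (gring_index 'Sym_('I_n)%G (p * q)%g).

(* The Specht module, as the submodule of the regular representation generated
   by the Young symmetrizer.  Both the group algebra and permutations act on
   the right here: (p * q)%g applies p first, so this right ideal is the left
   ideal generated by (column part)(row part) for the usual composition. *)
Definition specht (n : nat) (lambda : intpart n) : 'M[algC]_#|'Sym_('I_n)|%g :=
  cyclic_mx (Sym_regular n) (young_symmetrizer lambda).

Lemma specht_module (n : nat) (lambda : intpart n) :
  mxmodule (Sym_regular n) (specht lambda).
Proof. exact: cyclic_mx_module. Qed.

Definition specht_repr (n : nat) (lambda : intpart n) :
    mx_representation algC 'Sym_('I_n) (\rank (specht lambda)) :=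
  submod_repr (specht_module lambda).

Definition chi (n : nat) (lambda : intpart n) : 'CF('Sym_('I_n)) :=
  cfRepr (specht_repr lambda).

Definition kronecker (n : nat) (lambda mu nu : intpart n) : algC :=
  (n`!)%:R^-1 * \sum_(s : 'S_n) chi lambda s * chi mu s * chi nu s.

(* Main.v *)
Require Import Defs.
From HB Require Import structures.
From mathcomp Require Import all_boot all_order all_algebra.
From mathcomp Require Import all_fingroup all_solvable all_field all_character.
From mathcomp Require Import ring zify.

Import Order.TTheory GRing.Theory Num.Theory.
Local Open Scope ring_scope.

Set Implicit Arguments.
Unset Strict Implicit.
Unset Printing Implicit Defensive.

(** The character of a partition of level d is, up to the sign character, an
    irreducible character chi of the symmetric group on n points which has nonzero
    vectors fixed by the permutations of some n - d points, but none fixed by the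
    permutations of n - d + 1 points.  Let T be a set of d points.  Restricting chi
    to the stabilizer of T gives an irreducible character theta of that stabilizer,
    trivial on the permutations of the complement of T, such that chi is a
    constituent of the character induced from theta (exists_fixed_constituent);
    theta is in effect an irreducible character of the symmetric group on T, so
    theta(1)^2 <= d!.

    Upper bound.  By Cauchy-Schwarz the square of g is at most the squared norm of
    chi_lambda chi_mu, hence of Ind theta_1 Ind theta_2.  Pointwise,
    |Ind theta_1|^2 is at most the number of invariant d_1-subsets times the
    character induced from |theta_1|^2, and |Ind theta_2| is at most theta_2(1) times
    the number of invariant d_2-subsets.  So, by Frobenius reciprocity, everything is
    reduced to the mean of |theta_1|^2 weighted by third moments of numbers of small
    invariant subsets, which are exponential in d_2 (moment_invariant_subsets): a
    permutation that preserves U is a product of a permutation of U, responsible for a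
    factor 2^|U| at most, and a permutation of the complement, so that moments can be
    lowered one at a time.  Exchanging the two characters, the norm is at most the
    geometric mean theta_1(1) theta_2(1) 2^(9 d_2) of the two bounds (cfnorm_mul_le).

    Lower bound on chi(1).  Let p be the projection on the vectors fixed by the
    permutations of the complement of T, w its rank, and m = n - d.  As no vector is
    fixed by the permutations of m + 1 points, the operator p g p is determined by
    the action of Sym T: if g moves s points of T out of T, then p g p is, up to
    sign, (m - s)! / m! times a sum of s! operators t p with t in Sym T
    (avg_mulmx_comb).  By Schur's lemma, n! w^2 / chi(1) is the sum over g of the
    traces of p g p g^-1, each at most w / C(m, s)^2; counting the g with a given
    image of T gives C(n, d) w <= 2^d chi(1) (degree_lower_bound).  As
    theta(1) <= w and n^d <= d^d C(n, d), this converts theta_1(1) theta_2(1) into the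
    middle term of the theorem.

    The second inequality only uses chi(1) <= C(n, d) theta(1) <= C(n, d) d!^(1/2)
    and d^d <= 4^d d!.

    The facts about Specht modules follow from the classical study of the Young
    symmetrizer a b, with a and b the row and column sums: a A b is the line of a b
    in the group algebra A (sandwich), so positivity of x x^* gives irreducibility;
    a b a and a b are vectors fixed, up to sign, by the permutations of the first row
    and of the first column; and a transposition inside a column (row) kills the
    invariants of any set larger than the first row (column).  *)

Notation symOn A := (perm.Sym A).
Notation stab T := ('N(T | 'P))%G.

(** * Invariant subsets of a random permutation *)

Section InvariantSubsets.
Local Open Scope group_scope.
Variable T : finType.
Implicit Types (A U V X : {set T}) (s t r : {perm T}) (d k : nat).

Definition invariant_subsets d A s : {set {set T}} :=
  [set U : {set T} | [&& U \subset A, (#|U| <= d)%N & s @: U == U]].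

Lemma symOnP A s : reflect (forall x, x \notin A -> s x = x) (s \in symOn A).
Proof.
rewrite inE; apply: (iffP idP) => [pA x|fA]; first exact: out_perm.
by apply/subsetP=> x; rewrite inE; apply: contraR => /fA ->.
Qed.

Lemma symOn_imset A s : s \in symOn A -> s @: A = A.
Proof. by rewrite inE; apply: im_perm_on. Qed.

Lemma symOn_disjoint_imset A U s : s \in symOn A -> [disjoint U & A] -> s @: U = U.
Proof.
move=> /symOnP sA dUA; rewrite -[RHS]imset_id; apply: eq_in_imset => x Ux.
by rewrite sA // (disjointFr dUA).
Qed.

Lemma astabs_imset s U : (s \in 'N(U | 'P)) = (s @: U == U).
Proof.
apply/idP/eqP => [/astabsP sU|sU].
  apply/eqP; rewrite eqEcard card_imset ?leqnn ?andbT; last exact: perm_inj.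
  by apply/subsetP=> _ /imsetP[x Ux ->]; have := sU x; rewrite /= /aperm Ux.
by apply/astabsP=> x; rewrite /= /aperm -{1}sU mem_imset //; apply: perm_inj.
Qed.

Lemma split_symOn A U s : s \in symOn A -> s @: U = U -> U \subset A ->
  exists2 t, t \in symOn U & exists2 r, r \in symOn (A :\: U) & s = t * r.
Proof.
move=> /symOnP sA /eqP; rewrite -astabs_imset => sU sUA.
have sU' : s \in 'N(A :\: U | 'P).
  apply/astabsP=> x; rewrite /= /aperm !inE; move/astabsP: sU => /(_ x) /= ->.
  congr (_ && _); have [Ax|nAx] := boolP (x \in A); last by rewrite sA // (negPf nAx).
  by apply/negPn/negP=> nA; move/sA: (nA) => /perm_inj sx; rewrite sx Ax in nA.
exists (restr_perm U s); first by rewrite inE restr_perm_on.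
exists (restr_perm (A :\: U) s); first by rewrite inE restr_perm_on.
apply/permP=> x; rewrite permM.
have [Ux|nUx] := boolP (x \in U).
  have sxU : s x \in U by move/astabsP: sU => /(_ x) /= ->.
  by rewrite (restr_permE sU) // (out_perm (restr_perm_on _ _)) // !inE sxU.
rewrite (out_perm (restr_perm_on U s)) //.
have [Ax|nAx] := boolP (x \in A); first by rewrite restr_permE // inE nUx.
by rewrite (out_perm (restr_perm_on _ _)) ?sA // inE (negPf nAx) andbF.
Qed.

(** An invariant set is determined by its traces on the two blocks of the permutation; there
    are at most 2^|U| traces on U, and the trace on A :\: U is invariant under r. *)
Lemma card_invariant_subsets_mul d A U t r :
  t \in symOn U -> r \in symOn (A :\: U) ->
  (#|invariant_subsets d A (t * r)|
     <= 2 ^ #|U| * #|invariant_subsets d (A :\: U) r|)%N.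
Proof.
move=> tU rV; set V := A :\: U.
rewrite -card_powerset -cardsX.
pose f X := (X :&: U, X :&: V).
have tV : t @: V = V.
  apply: symOn_disjoint_imset tU _.
  by rewrite disjoint_sym -setI_eq0 /V; apply/eqP/setP=> x; rewrite !inE; case: (x \in U).
have eqV x : x \in V -> (t * r) x = r x.
  rewrite permM => /setDP[_ nUx]; congr (r _); exact: (symOnP _ _ tU).
rewrite -(card_in_imset (f := f) (D := mem (invariant_subsets d A (t * r)))).
  apply: subset_leq_card; apply/subsetP=> _ /imsetP[X + ->].
  rewrite !inE /= => /and3P[sXA cX /eqP iX]; rewrite !subsetIr /=.
  rewrite (leq_trans (subset_leq_card (subsetIl _ _)) cX) /=.
  have -> : r @: (X :&: V) = (t * r) @: (X :&: V).
    by apply: eq_in_imset => x /setIP[_ Vx]; rewrite eqV.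
  rewrite imsetI; last by move=> x y _ _; apply: perm_inj.
  rewrite iX (eq_in_imset (g := r)); last by move=> x; apply: eqV.
  by rewrite (symOn_imset rV).
move=> X Y /[!inE] /and3P[sXA _ _] /and3P[sYA _ _] [eU eV].
by rewrite -(setID X U) -(setID Y U) eU -(setIidPl sXA) -(setIidPl sYA) -!setIDA eV.
Qed.

(** The recursion is the one of the proof of moment_invariant_subsets: splitting off one
    invariant set of size j <= d costs 2^(d k) for the other k sets. *)
Fixpoint moment_bound d k : nat :=
  if k is k'.+1 then d.+1 * 2 ^ (d * k') * moment_bound d k' else 1.

(** The sets of a given size j contribute C(|A|, j) j! (|A| - j)! = |A|! together. *)
Lemma sum_fact_card d A :
  (\sum_(U : {set T} | (U \subset A) && (#|U| <= d)%N) #|U|`! * (#|A| - #|U|)`!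
     <= d.+1 * #|A|`!)%N.
Proof.
rewrite (partition_big (fun U => inord #|U| : 'I_d.+1) predT) //=.
rewrite -[X in (_ <= X * _)%N]card_ord -sum_nat_const; apply: leq_sum => j _.
apply: (@leq_trans
  (\sum_(U in [set U : {set T} | U \subset A & #|U| == j]) (j`! * (#|A| - j)`!))%N).
  rewrite [X in (X <= _)%N](eq_bigr (fun=> j`! * (#|A| - j)`!)%N); last first.
    by move=> U /andP[/andP[_ cU] /eqP<-]; rewrite inordK.
  rewrite [X in (X <= _)%N]big_mkcond [X in (_ <= X)%N]big_mkcond /=.
  apply: leq_sum => U _; rewrite inE.
  case: ifP => // /andP[/andP[-> cU] /eqP<-].
  by rewrite inordK // eqxx.
rewrite sum_nat_const cards_draws.
have [jA|Aj] := leqP j #|A|; first by rewrite bin_fact.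
by rewrite bin_small.
Qed.

Lemma leq_expn2r m1 m2 k : (m1 <= m2)%N -> (m1 ^ k <= m2 ^ k)%N.
Proof. by case: k => // k; rewrite leq_exp2r. Qed.

(** Expanding one of the k + 1 factors as a sum over an invariant set U, the permutation
    splits over U and A :\: U; the part on A :\: U is handled by the k-th moment. *)
Lemma moment_invariant_subsets d k A :
  (\sum_(s in symOn A) #|invariant_subsets d A s| ^ k <= #|A|`! * moment_bound d k)%N.
Proof.
elim: k A => [|k IHk] A.
  by rewrite (eq_bigr (fun=> 1%N)) // sum1_card perm.card_Sym muln1.
pose N A s := #|invariant_subsets d A s|.
have step U : U \subset A -> (#|U| <= d)%N ->
  (\sum_(s in symOn A | s @: U == U) N A s ^ k
     <= #|U|`! * (#|A| - #|U|)`! * (2 ^ (d * k) * moment_bound d k))%N.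
  move=> sUA cU; set V := A :\: U.
  pose P s (p : {perm T} * {perm T}) :=
    [&& p.1 \in symOn U, p.2 \in symOn V & s == p.1 * p.2].
  apply: (@leq_trans (\sum_(s in symOn A | s @: U == U) \sum_(p | P s p) N A s ^ k)%N).
    apply: leq_sum => s /andP[sA /eqP sU].
    have [t tU [r rV def_s]] := split_symOn sA sU sUA.
    by rewrite (bigD1 (t, r)) ?leq_addr // /P /= tU rV def_s eqxx.
  rewrite (exchange_big_dep (fun p => (p.1 \in symOn U) && (p.2 \in symOn V))) /=; last first.
    by move=> s p _ /and3P[-> ->].
  apply: (@leq_trans (\sum_(p : {perm T} * {perm T} | (p.1 \in symOn U) && (p.2 \in symOn V))
             2 ^ (d * k) * N V p.2 ^ k)%N).
    apply: leq_sum => -[t r] /andP[/= tU rV].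
    apply: (@leq_trans (\sum_(s | s == (t * r)%g) N A s ^ k)%N).
      rewrite [X in (X <= _)%N]big_mkcond [X in (_ <= X)%N]big_mkcond /=.
      apply: leq_sum => s _; rewrite /P /=.
      by case: ifP => // /and3P[_ _ /andP[_ ->]].
    rewrite big_pred1_eq expnM -expnMn leq_expn2r //.
    apply: leq_trans (card_invariant_subsets_mul d tU rV) _.
    by rewrite leq_mul2r leq_exp2l // cU orbT.
  apply: (@leq_trans (\sum_(t in symOn U) \sum_(r in symOn V) 2 ^ (d * k) * N V r ^ k)%N).
    by rewrite pair_big.
  rewrite sum_nat_const perm.card_Sym -mulnA leq_mul2l -big_distrr /=.
  rewrite mulnCA leq_mul2l (leq_trans (IHk V)) ?orbT //.
  by rewrite cardsD (setIidPr sUA).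
rewrite (eq_bigr (fun s => \sum_(U in invariant_subsets d A s) N A s ^ k)%N); last first.
  by move=> s _; rewrite sum_nat_const expnS.
rewrite (exchange_big_dep (fun U => (U \subset A) && (#|U| <= d)%N)) /=; last first.
  by move=> s U _; rewrite inE => /and3P[-> ->].
apply: (@leq_trans (\sum_(U : {set T} | (U \subset A) && (#|U| <= d)%N)
   #|U|`! * (#|A| - #|U|)`! * (2 ^ (d * k) * moment_bound d k))%N).
  apply: leq_sum => U /andP[sUA cU]; apply: leq_trans (step U sUA cU).
  by apply: eq_leq; apply: eq_bigl => s; rewrite [U \in _]inE sUA cU.
rewrite -big_distrl /= (leq_trans (leq_mul (sum_fact_card d A) (leqnn _))) //.
by apply: eq_leq; rewrite [RHS]/= ; ring.
Qed.

Lemma moment_bound3 d : (moment_bound d 3 <= 2 ^ (6 * d))%N.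
Proof.
have dX : (d.+1 <= 2 ^ d)%N by apply: ltn_expl.
rewrite /= muln0 !muln1.
rewrite (_ : 2 ^ (6 * d) = 2 ^ d * 2 ^ (d * 2) * (2 ^ d * 2 ^ d * 2 ^ d))%N; last first.
  by rewrite -!expnD; congr (2 ^ _)%N; lia.
by rewrite !leq_mul.
Qed.

End InvariantSubsets.

(** * Fourth moments of induced characters *)

Lemma sqr_sum_le (I : finType) (S : {pred I}) (a : I -> algC) :
  (\sum_(i in S) `|a i|) ^+ 2 <= #|S|%:R * \sum_(i in S) `|a i| ^+ 2.
Proof.
have -> : #|S|%:R * \sum_(i in S) `|a i| ^+ 2
    = \sum_(i in S) \sum_(j in S) (`|a i| ^+ 2 + `|a j| ^+ 2) / 2%:R.
  under [RHS]eq_bigr => i _ do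
    rewrite -mulr_suml big_split /= sumr_const.
  rewrite -mulr_suml big_split /= sumr_const sumrMnl.
  by set c := \sum_(i in S) _; rewrite -[c *+ _]mulr_natl; field.
rewrite expr2 mulr_suml ler_sum // => i _; rewrite mulr_sumr ler_sum // => j _.
rewrite ler_pdivlMr ?ltr0n // -subr_ge0.
have -> : `|a i| ^+ 2 + `|a j| ^+ 2 - `|a i| * `|a j| * 2%:R = (`|a i| - `|a j|) ^+ 2 by ring.
by rewrite real_exprn_even_ge0 // realB // normr_real.
Qed.

Lemma sum_norm_irr (gT : finGroupType) (G : {group gT}) (theta : 'CF(G)) :
  theta \in irr G -> \sum_(h in G) `|theta h| ^+ 2 = #|G|%:R.
Proof.
case/irrP=> i ->; apply: (mulfI (invr_neq0 (neq0CG G))).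
by rewrite -(cfnormE (cfun_onG _)) cfnorm_irr mulVf ?neq0CG.
Qed.

Section Induced.
Variable X : finType.
Implicit Types (T U : {set X}) (g h s t r : {perm X}) (d k : nat).

Definition fixed_sets k s : nat := #|[set U : {set X} | (#|U| == k) && (s @: U == U)]|.

Lemma imset_mulp s t U : (s * t)%g @: U = t @: (s @: U).
Proof. by rewrite -imset_comp; apply: eq_imset => x; rewrite /= permM. Qed.

Lemma imset_permKV s U : s @: (s^-1%g @: U) = U.
Proof. by rewrite -imset_mulp mulVg -[RHS]imset_id; apply: eq_imset => x; rewrite perm1. Qed.

Lemma imset_permK s U : s^-1%g @: (s @: U) = U.
Proof. by rewrite -imset_mulp mulgV -[RHS]imset_id; apply: eq_imset => x; rewrite perm1. Qed.

Lemma fixed_setsJ k g h : fixed_sets k (g ^ h)%g = fixed_sets k g.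
Proof.
have le_fix s t : (fixed_sets k s <= fixed_sets k (s ^ t)%g)%N.
  have inj_t : injective (fun U : {set X} => t @: U).
    exact: (can_inj (g := fun U : {set X} => t^-1%g @: U) (imset_permK t)).
  rewrite /fixed_sets -(card_imset (pred_of_set _) inj_t); apply: subset_leq_card.
  apply/subsetP => _ /imsetP[U + ->]; rewrite !inE card_imset; last exact: perm_inj.
  by move=> /andP[-> /eqP iU]; rewrite conjgE !imset_mulp imset_permK iU /=.
apply/eqP; rewrite eqn_leq le_fix andbT. have := le_fix (g ^ h)%g h^-1%g. by rewrite conjgK.
Qed.

(** The stabilizer of T is the direct product of Sym T and Sym (~: T). *)
Lemma sum_stab (R : nmodType) T (F : {perm X} -> R) :
  \sum_(h in stab T) F h = \sum_(t in symOn T) \sum_(r in symOn (~: T)) F (t * r)%g.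
Proof.
rewrite pair_big /=; set S := setX (symOn T) (symOn (~: T)).
rewrite [RHS](eq_bigl (fun p => p \in S)); last by move=> [t r]; rewrite /S in_setX.
rewrite -(big_imset F (h := fun p => (p.1 * p.2)%g)) /=.
  apply: eq_bigl => h; apply/idP/imsetP => [|[[t r] /setXP[/= tT rT] ->]].
    rewrite astabs_imset => /eqP hT.
    have hX : h \in symOn [set: X] by apply/symOnP => x; rewrite inE.
    have [t tT [r rT ->]] := split_symOn hX hT (subsetT T).
    by exists (t, r); rewrite // inE tT -setTD.
  rewrite astabs_imset imset_mulp (symOn_imset tT) (symOn_disjoint_imset rT) //.
  by rewrite -setI_eq0 setICr.
move=> [t r] [t' r'] /setXP[/= tT rT] /setXP[/= tT' rT'] /permP eq_tr.
have fixr s x : s \in symOn (~: T) -> x \in T -> s x = x.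
  by move=> /symOnP sT xT; rewrite sT // inE xT.
have stT s x : s \in symOn T -> (s x \in T) = (x \in T).
  by rewrite inE => sT; apply: perm_closed.
have eqt : t = t'.
  apply/permP=> x; have [xT|xT] := boolP (x \in T).
    by have := eq_tr x; rewrite !permM (fixr r) ?stT // (fixr r') ?stT.
  by rewrite (symOnP _ _ tT) // (symOnP _ _ tT').
rewrite -eqt in eq_tr *; congr (_, _); apply/permP=> x.
by have := eq_tr (t^-1%g x); rewrite !permM permKV.
Qed.

Lemma card_stab T : #|stab T| = (#|T|`! * #|~: T|`!)%N.
Proof.
rewrite -sum1_card sum_stab.
by rewrite !sumr_const !perm.card_Sym -mulrnA natn mulnC.
Qed.

Lemma fixed_sets_mul d k T t r : (k <= d)%N -> t \in symOn T -> r \in symOn (~: T) ->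
  (fixed_sets k (t * r)%g <= 2 ^ #|T| * #|invariant_subsets d (~: T) r|)%N.
Proof.
move=> kd tT rT; rewrite -setTD in rT *.
apply: leq_trans (card_invariant_subsets_mul d tT rT); apply: subset_leq_card.
by apply/subsetP=> U; rewrite !inE subsetT => /andP[/eqP-> ->]; rewrite kd.
Qed.

(** Each count is at most 2^d times a count that depends on the second component only;
    |theta|^2 depends on the first component only, so the bound is a product. *)
Lemma weighted_fixed_sets d k1 k2 k3 T (theta : 'CF(stab T)) :
    (k1 <= d)%N -> (k2 <= d)%N -> (k3 <= d)%N -> (#|T| <= d)%N ->
    symOn (~: T) \subset cfker theta ->
  \sum_(h in stab T) `|theta h| ^+ 2
      * (fixed_sets k1 h * fixed_sets k2 h * fixed_sets k3 h)%:R
    <= (2 ^ (9 * d))%:R * \sum_(h in stab T) `|theta h| ^+ 2.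
Proof.
move=> k1d k2d k3d Td kerT; rewrite !sum_stab.
have theta_mul t r : r \in symOn (~: T) -> theta (t * r)%g = theta t.
  by move=> rT; apply: cfkerMr; apply: (subsetP kerT).
under [X in _ <= _ * X]eq_bigr => t _.
  under eq_bigr => r rT do rewrite theta_mul //.
  rewrite sumr_const perm.card_Sym -mulr_natr; over.
rewrite mulr_sumr; apply: ler_sum => t tT.
under eq_bigr => r rT do rewrite theta_mul //.
rewrite -mulr_sumr [leRHS]mulrCA ler_wpM2l ?exprn_ge0 //.
rewrite -natr_sum -natrM ler_nat.
apply: (@leq_trans (\sum_(r in symOn (~: T))
    2 ^ (3 * d) * #|invariant_subsets d (~: T) r| ^ 3)%N).
  apply: leq_sum => r rT; rewrite [(3 * d)%N]mulnC expnM -expnMn !expnS expn0 muln1 mulnA.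
  have leN k : (k <= d)%N ->
      (fixed_sets k (t * r)%g <= 2 ^ d * #|invariant_subsets d (~: T) r|)%N.
    move=> kd; apply: leq_trans (fixed_sets_mul kd tT rT) _.
    by rewrite leq_mul2r leq_exp2l // Td orbT.
  by rewrite !leq_mul ?leN.
rewrite -big_distrr /= (_ : 9 * d = 3 * d + 6 * d)%N; last by lia.
rewrite expnD -mulnA leq_mul2l; apply/orP; right.
rewrite mulnC (leq_trans (moment_invariant_subsets d 3 _)) // leq_mul2l.
by rewrite moment_bound3 orbT.
Qed.

(** The condition says that g preserves the image of T under the inverse of y, and each
    image is obtained for at most |stab T| elements y. *)
Lemma card_transporter T g :
  (#|[set y : {perm X} | (g ^ y)%g \in stab T]| <= #|stab T| * fixed_sets #|T| g)%N.
Proof.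
rewrite /fixed_sets; set Y := [set y | _]; set S := [set U | _].
rewrite -sum1_card (partition_big (fun y : {perm X} => y^-1%g @: T) (mem S)) /=; last first.
  move=> y; rewrite inE astabs_imset => /eqP iT; rewrite inE card_imset; last exact: perm_inj.
  by rewrite eqxx -{2}iT conjgE !imset_mulp imset_permK eqxx.
rewrite mulnC -sum_nat_const; apply: leq_sum => U _.
pose F := [pred y : {perm X} | (y \in Y) && (y^-1%g @: T == U)].
rewrite (eq_bigl F) // sum1_card; have [y0 Fy0|F0] := pickP F; last by rewrite eq_card0.
rewrite -(card_imset F (mulgI y0^-1%g)); apply: subset_leq_card.
apply/subsetP => _ /imsetP[y /andP[_ /eqP yT] ->].
move: Fy0 => /andP[_ /eqP y0T].
by rewrite astabs_imset imset_mulp y0T -{1}yT imset_permKV.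
Qed.

Section Bounds.
Variables (T : {set X}) (theta : 'CF(stab T)).

Let psi := 'Ind['Sym_X] theta.

Let psiE g : psi g = #|stab T|%:R^-1 *
  \sum_(y in [set y : {perm X} | (g ^ y)%g \in stab T]) theta (g ^ y)%g.
Proof.
rewrite /psi cfIndE ?subsetT //; congr (_ * _).
rewrite [RHS]big_mkcond /=; apply: eq_big => [y|y _]; first by rewrite inE.
by rewrite inE; case: ifPn => // /cfun0.
Qed.

Let card_transporterR g : #|[set y : {perm X} | (g ^ y)%g \in stab T]|%:R
  <= #|stab T|%:R * (fixed_sets #|T| g)%:R :> algC.
Proof. by rewrite -natrM ler_nat card_transporter. Qed.

Lemma cfInd_norm_le g : theta \is a character ->
  `|psi g| <= theta 1%g * (fixed_sets #|T| g)%:R.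
Proof.
move=> ch; rewrite psiE normrM normfV normr_nat ler_pdivrMl ?ltr0n ?cardG_gt0 //.
rewrite mulrCA; apply: le_trans (ler_norm_sum _ _ _) _.
apply: le_trans (ler_wpM2l (char1_ge0 ch) (card_transporterR g)).
rewrite mulr_natr -sumr_const; apply: ler_sum => y _.
exact: char1_ge_norm.
Qed.

(** The value at g of the class function induced from |theta|^2. *)
Definition sqnorm_ind g : algC := #|stab T|%:R^-1 * \sum_y `|theta (g ^ y)%g| ^+ 2.

Lemma cfInd_sqnorm_le g : `|psi g| ^+ 2 <= (fixed_sets #|T| g)%:R * sqnorm_ind g.
Proof.
have cT : 0 < #|stab T|%:R :> algC by rewrite ltr0n cardG_gt0.
rewrite psiE normrM normfV normr_nat exprMn exprVn ler_pdivrMl ?exprn_gt0 //.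
set Y := [set y | _].
apply: (@le_trans _ _ ((\sum_(y in Y) `|theta (g ^ y)%g|) ^+ 2)).
  by rewrite lerXn2r ?nnegrE ?normr_ge0 ?sumr_ge0 ?ler_norm_sum.
apply: le_trans (sqr_sum_le _ _) _.
have -> : \sum_(y in Y) `|theta (g ^ y)%g| ^+ 2 = \sum_y `|theta (g ^ y)%g| ^+ 2.
  rewrite [LHS]big_mkcond /=; apply: eq_bigr => y _.
  by rewrite inE; case: ifPn => // /cfun0->; rewrite normr0 expr0n.
rewrite /sqnorm_ind; set B := \sum_y _.
have -> : #|stab T|%:R ^+ 2 * ((fixed_sets #|T| g)%:R * (#|stab T|%:R^-1 * B))
    = #|stab T|%:R * (fixed_sets #|T| g)%:R * B.
  by field; rewrite gt_eqF.
by rewrite ler_wpM2r ?card_transporterR ?sumr_ge0 // => y _; rewrite exprn_ge0.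
Qed.

End Bounds.

(** The two bounds on induced characters leave the mean over the group of the character
    induced from |th1|^2 times a product of three counts, which is a mean over the
    stabilizer. *)
Lemma cfdot_Ind_mul_le d T1 T2 (th1 : 'CF(stab T1)) (th2 : 'CF(stab T2)) :
    (#|T1| <= d)%N -> (#|T2| <= d)%N -> th1 \in irr (stab T1) -> th2 \in irr (stab T2) ->
    symOn (~: T1) \subset cfker th1 ->
  '['Ind['Sym_X] th1 * 'Ind['Sym_X] th2] <= th2 1%g ^+ 2 * (2 ^ (9 * d))%:R.
Proof.
move=> T1d T2d irr1 irr2 ker1; have norm1 := sum_norm_irr irr1.
have ch2 : th2 \is a character by have /irrP[i ->] := irr2; apply: irr_char.
pose c1 := fixed_sets #|T1|; pose c2 := fixed_sets #|T2|.
rewrite (cfnormE (cfun_onG _)).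
rewrite ler_pdivrMl ?ltr0n ?cardG_gt0 // [leRHS]mulrCA.
apply: (@le_trans _ _ (\sum_(g in ('Sym_X)%g)
  th2 1%g ^+ 2 * ((c1 g * c2 g * c2 g)%:R * sqnorm_ind th1 g))).
  apply: ler_sum => g _; rewrite cfunE normrM exprMn mulrC.
  have -> : th2 1%g ^+ 2 * ((c1 g * c2 g * c2 g)%:R * sqnorm_ind th1 g)
    = (th2 1%g * (c2 g)%:R) ^+ 2 * ((c1 g)%:R * sqnorm_ind th1 g) by rewrite !natrM; ring.
  rewrite ler_pM ?exprn_ge0 ?cfInd_sqnorm_le //.
  rewrite lerXn2r ?nnegrE ?cfInd_norm_le // mulr_ge0 ?ler0n //; exact: char1_ge0.
rewrite -mulr_sumr ler_wpM2l ?exprn_ge0 //; first exact: char1_ge0.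
have -> : \sum_(g in ('Sym_X)%g) (c1 g * c2 g * c2 g)%:R * sqnorm_ind th1 g
  = #|('Sym_X)%g|%:R * (#|stab T1|%:R^-1 *
      \sum_(h in stab T1) `|th1 h| ^+ 2 * (c1 h * c2 h * c2 h)%:R).
  rewrite /sqnorm_ind [RHS]mulrCA.
  under eq_bigr => g _ do rewrite mulrCA.
  rewrite -mulr_sumr; congr (_ * _).
  under eq_bigr => g _ do rewrite mulr_sumr.
  rewrite exchange_big /= mulr_natl -sumr_const [RHS]big_mkcond /=.
  apply: eq_bigr => y _; rewrite inE.
  rewrite (reindex_inj (conjg_inj y^-1%g)) /= big_mkcond [RHS]big_mkcond /=.
  apply: eq_bigr => h _; rewrite inE conjgKV /c1 /c2 !fixed_setsJ mulrC.
  by case: ifPn => // /cfun0->; rewrite normr0 expr0n mul0r.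
rewrite ler_wpM2l ?ler0n // ler_pdivrMl ?ltr0n ?cardG_gt0 // mulrC -norm1.
exact: weighted_fixed_sets.
Qed.

End Induced.

(** * Vectors fixed by a subset of the points *)

Lemma idem_base_mul (F : fieldType) m (p : 'M[F]_m) :
  p *m p = p -> row_base p *m col_base p = 1%:M.
Proof.
move=> pp; have /row_freeP[R rR] := row_base_free p; have /row_fullP[C cC] := col_base_full p.
move: pp rR cC; rewrite -[in p *m p](mulmx_base p) -[in RHS](mulmx_base p).
move: (col_base p) (row_base p) => c r pp rR cC.
have : C *m ((c *m r) *m (c *m r)) *m R = C *m (c *m r) *m R by rewrite pp.
by rewrite !mulmxA cC mul1mx -!mulmxA rR !mulmx1.
Qed.

Lemma mxtrace_idem (F : fieldType) m (p : 'M[F]_m) : p *m p = p -> \tr p = (\rank p)%:R.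
Proof. by move=> /idem_base_mul pp; rewrite -{1}(mulmx_base p) mxtrace_mulC pp mxtrace1. Qed.

Section Average.
Variables (X : finType) (m : nat) (rG : mx_representation algC 'Sym_X m).
Implicit Types (A B T : {set X}) (g h s t : {perm X}).

(** The projection on the vectors fixed by Sym A. *)
Definition avg_mx A : 'M[algC]_m := #|symOn A|%:R^-1 *: \sum_(a in symOn A) rG a.

Let rGM s t : rG (s * t)%g = rG s *m rG t.
Proof. by rewrite repr_mxM ?inE. Qed.

Lemma avg_mxMr A a : a \in symOn A -> avg_mx A *m rG a = avg_mx A.
Proof.
move=> aA; rewrite -scalemxAl mulmx_suml; congr (_ *: _).
under eq_bigr => b _ do rewrite -rGM.
rewrite [LHS](reindex_inj (mulIg a^-1%g)) /=.
by apply: eq_big => [b|b _]; rewrite ?groupMr ?groupV // mulgKV.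
Qed.

Lemma avg_mxMl A a : a \in symOn A -> rG a *m avg_mx A = avg_mx A.
Proof.
move=> aA; rewrite -scalemxAr mulmx_sumr; congr (_ *: _).
under eq_bigr => b _ do rewrite -rGM.
rewrite [LHS](reindex_inj (mulgI a^-1%g)) /=.
by apply: eq_big => [b|b _]; rewrite ?groupMl ?groupV // mulKVg.
Qed.

Lemma avg_mxJ A g : avg_mx A *m rG g = rG g *m avg_mx (g @: A).
Proof.
rewrite /avg_mx -scalemxAl -scalemxAr mulmx_suml mulmx_sumr.
rewrite !perm.card_Sym card_imset; last exact: perm_inj.
congr (_ *: _); rewrite [RHS](reindex_inj (conjg_inj g)) /=.
apply: eq_big => [a|a _]; last by rewrite -!rGM conjgE !mulgA mulgV mul1g.
apply/symOnP/symOnP=> aA x xA.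
  rewrite conjgE !permM aA ?permKV //; apply: contra xA => /(imset_f g).
  by rewrite permKV.
have /aA : g x \notin g @: A by rewrite mem_imset //; apply: perm_inj.
by rewrite conjgE !permM permK => /perm_inj.
Qed.

Lemma avg_mx_idem A : avg_mx A *m avg_mx A = avg_mx A.
Proof.
rewrite {1}/avg_mx -scalemxAl mulmx_suml.
under eq_bigr => a aA do rewrite avg_mxMl //.
by rewrite sumr_const -scaler_nat scalerA mulVf ?scale1r ?neq0CG.
Qed.

Lemma mxtrace_avg A : \tr (avg_mx A) = '['Res[symOn A] (cfRepr rG), 1].
Proof.
rewrite cfdotE mxtraceZ raddf_sum; congr (_ * _); apply: eq_bigr => a aA.
by rewrite cfResE ?subsetT // cfunE inE cfun1E aA conjC1 mulr1 mulr1n.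
Qed.

Lemma symOn_sub_stab A T : [disjoint T & A] -> symOn A \subset stab T.
Proof.
by move=> dTA; apply/subsetP=> a aA; rewrite astabs_imset (symOn_disjoint_imset aA).
Qed.

Lemma symOn_compl_normal T : (symOn (~: T) <| stab T)%g.
Proof.
rewrite /normal symOn_sub_stab -?setI_eq0 ?setICr //=.
apply/subsetP=> h; rewrite astabs_imset => /eqP hT; rewrite inE.
apply/subsetP=> _ /imsetP[a /symOnP aT ->]; apply/symOnP => x; rewrite inE negbK -{1}hT.
by case/imsetP=> y yT ->; rewrite conjgE !permM permK aT // inE yT.
Qed.

(** A fixed vector makes the trivial character of Sym (~: T) a constituent of the restriction,
    hence of the restriction of some constituent theta of the restriction to the
    stabilizer; as Sym (~: T) is normal there, it acts trivially on theta. *)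
Lemma exists_fixed_constituent T : mx_irreducible rG -> avg_mx (~: T) != 0 ->
  exists theta : 'CF(stab T),
    [/\ theta \in irr (stab T), symOn (~: T) \subset cfker theta,
        theta 1%g <= (\rank (avg_mx (~: T)))%:R
      & exists2 chi', chi' \is a character & 'Ind['Sym_X] theta = cfRepr rG + chi'].
Proof.
move=> irrG nz; have /irrP[i def_i] : cfRepr rG \in irr 'Sym_X.
  by apply/irr_reprP; exists (Representation rG).
set A := ~: T in nz *; have nsA : (symOn A <| stab T)%g by apply: symOn_compl_normal.
have sA := normal_sub nsA; have chR : 'Res[stab T] (cfRepr rG) \is a character.
  by rewrite cfRes_char ?cfRepr_char.
have : '['Res[symOn A] ('Res[stab T] (cfRepr rG)), 1] != 0.
  by rewrite cfResRes ?subsetT // -mxtrace_avg mxtrace_idem ?avg_mx_idem // pnatr_eq0 mxrank_eq0.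
rewrite cfdot_Res_l cfdot_sum_irr => nz_sum.
have [j nzj] : exists j,
    '['Res[stab T] (cfRepr rG), 'chi_j] * '['Ind[stab T, symOn A] 1, 'chi_j]^* != 0.
  apply/existsP; apply: contraNT nz_sum => /existsPn zero.
  by apply/eqP/big1 => j _; apply/eqP/negPn/zero.
move: nzj; rewrite mulf_eq0 conjC_eq0 negb_or => /andP[cj nzj].
have kerj : symOn A \subset cfker 'chi_j.
  apply: constt0_Res_cfker => //.
  by rewrite irr_consttE irr0 cfdot_Res_l cfdotC conjC_eq0.
have [chi1 ch1 def1] : exists2 c, c \is a character & 'Res[stab T] (cfRepr rG) = 'chi_j + c.
  by apply/constt_charP.
exists 'chi_j; split; first exact: mem_irr.
- exact: kerj.
- rewrite -mxtrace_idem ?avg_mx_idem // mxtrace_avg -(cfResRes _ sA) ?subsetT //.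
  rewrite def1 raddfD /= cfdotDl.
  have -> : '['Res[symOn A] 'chi_j, 1] = 'chi_j 1%g.
    rewrite cfRes_sub_ker // cfdotZl cfnorm1 mulr1 //.
  by rewrite lerDl natr_ge0 // Cnat_cfdot_char ?cfun1_char ?cfRes_char.
- rewrite def_i; apply/constt_charP; first by rewrite cfInd_char ?irr_char.
  by rewrite irr_consttE cfdotC conjC_eq0 -cfdot_Res_l -def_i.
Qed.

End Average.

Section Degrees.
Variable X : finType.

(** theta is in effect a character of Sym T, of order |T|!, with the same norm. *)
Lemma degree_sqr_le (T : {set X}) (theta : 'CF(stab T)) :
  theta \in irr (stab T) -> symOn (~: T) \subset cfker theta -> theta 1%g ^+ 2 <= (#|T|`!)%:R.
Proof.
move=> irr_th kerT; have ch : theta \is a character by have /irrP[i ->] := irr_th; apply: irr_char.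
have := sum_norm_irr irr_th; rewrite sum_stab card_stab.
under eq_bigr => t tT.
  under eq_bigr => r rT do rewrite cfkerMr ?(subsetP kerT) //.
  rewrite sumr_const perm.card_Sym -mulr_natr; over.
rewrite -mulr_suml natrM => /mulIf <-; last by rewrite pnatr_eq0 -lt0n fact_gt0.
rewrite (bigD1 1%g) ?group1 //= ger0_norm ?char1_ge0 // lerDl.
by rewrite sumr_ge0 // => t _; rewrite exprn_ge0.
Qed.

Lemma card_Sym_bin (T : {set X}) : #|'Sym_X|%g = ('C(#|X|, #|T|) * #|stab T|)%N.
Proof.
rewrite card_stab (_ : #|~: T| = #|X| - #|T|)%N; last by rewrite cardsCs setCK.
rewrite bin_fact ?max_card // -cardsT /= -(perm.card_Sym [set: X]).
by apply: eq_card => s; rewrite inE; apply/esym/symOnP => x; rewrite inE.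
Qed.

Lemma index_stab (T : {set X}) : #|'Sym_X : stab T|%g = 'C(#|X|, #|T|).
Proof.
by rewrite -divgS ?subsetT // (card_Sym_bin T) mulnK ?cardG_gt0.
Qed.

(** The bound of cfdot_Ind_mul_le with the square of either degree implies the bound with
    their product. *)
Lemma cfnorm_mul_le d (T1 T2 : {set X}) (th1 : 'CF(stab T1)) (th2 : 'CF(stab T2))
    (chi1 chi2 : 'CF('Sym_X)) :
    (#|T1| <= d)%N -> (#|T2| <= d)%N -> th1 \in irr (stab T1) -> th2 \in irr (stab T2) ->
    symOn (~: T1) \subset cfker th1 -> symOn (~: T2) \subset cfker th2 ->
    chi1 \is a character -> chi2 \is a character ->
    (exists2 c, c \is a character & 'Ind['Sym_X] th1 = chi1 + c) ->
    (exists2 c, c \is a character & 'Ind['Sym_X] th2 = chi2 + c) ->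
  '[chi1 * chi2] <= th1 1%g * th2 1%g * (2 ^ (9 * d))%:R.
Proof.
move=> T1d T2d irr1 irr2 ker1 ker2 ch1 ch2 [c1 chc1 I1] [c2 chc2 I2].
set I := 'Ind['Sym_X] th1 * 'Ind['Sym_X] th2.
have [c chc defI] : exists2 c, c \is a character & I = chi1 * chi2 + c.
  exists (chi1 * c2 + c1 * (chi2 + c2)); first by rewrite !(rpredD, rpredM).
  by rewrite /I I1 I2 mulrDl mulrDr addrA.
have le_I : '[chi1 * chi2] <= '[I].
  rewrite defI cfdotDl !cfdotDr -addrA lerDl !addr_ge0 // natr_ge0 // Cnat_cfdot_char ?rpredM //.
apply: le_trans le_I _.
have th1_ge0 : 0 <= th1 1%g by apply: char1_ge0; have /irrP[i ->] := irr1; apply: irr_char.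
have th2_ge0 : 0 <= th2 1%g by apply: char1_ge0; have /irrP[i ->] := irr2; apply: irr_char.
have b2 : '[I] <= th2 1%g ^+ 2 * (2 ^ (9 * d))%:R by apply: cfdot_Ind_mul_le.
have b1 : '[I] <= th1 1%g ^+ 2 * (2 ^ (9 * d))%:R by rewrite /I mulrC; apply: cfdot_Ind_mul_le.
rewrite -(@ler_pXn2r _ 2) ?nnegrE ?cfnorm_ge0 // ?mulr_ge0 ?ler0n // expr2.
apply: le_trans (ler_pM (cfnorm_ge0 _) (cfnorm_ge0 _) b1 b2) _.
by rewrite le_eqVlt; apply/orP; left; apply/eqP; ring.
Qed.

End Degrees.

(** * A lower bound for the degree *)

Section LowerBound.
Variables (X : finType) (m : nat) (rG : mx_representation algC 'Sym_X m).
Variable T : {set X}.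
Implicit Types (A B U : {set X}) (g h s t a : {perm X}).

Let A := ~: T.
Let p := avg_mx rG A.
Let w := \rank p.

Let rGM s t : rG (s * t)%g = rG s *m rG t.
Proof. by rewrite repr_mxM ?inE. Qed.

Let pp : p *m p = p. Proof. exact: avg_mx_idem. Qed.

Lemma symOn_imset_compl t : t \in symOn T -> t @: A = A.
Proof. by move=> tT; apply: symOn_disjoint_imset tT _; rewrite disjoint_sym -setI_eq0 setICr. Qed.

Lemma avg_mx_compl_comm t : t \in symOn T -> p *m rG t = rG t *m p.
Proof. by move=> tT; rewrite /p avg_mxJ symOn_imset_compl. Qed.

(** Sym T commutes with Sym A, so it acts on the fixed vectors, and the trace on the left
    is a value of the character, of degree w, of this action. *)
Lemma norm_mxtrace_fixed t : t \in symOn T -> `|\tr (rG t *m p)| <= w%:R.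
Proof.
move=> tT; have [cb [rb [cb_rb rb_cb]]] : exists cb rb,
    cb *m rb = p /\ rb *m cb = 1%:M :> 'M_w.
  by exists (col_base p), (row_base p); rewrite mulmx_base idem_base_mul.
pose r s := rb *m rG s *m cb.
have rb_p : rb *m p = rb by rewrite -cb_rb mulmxA rb_cb mul1mx.
have repr_r : mx_repr (symOn T) r.
  split=> [|s s' sT s'T]; first by rewrite /r repr_mx1 mulmx1.
  have -> : r s *m r s' = rb *m rG s *m (cb *m rb) *m rG s' *m cb by rewrite /r !mulmxA.
  rewrite cb_rb -(mulmxA rb) -avg_mx_compl_comm // mulmxA rb_p. by rewrite /r rGM mulmxA.
pose rT := MxRepresentation repr_r.
have -> : \tr (rG t *m p) = cfRepr rT t.
  by rewrite cfunE tT mulr1n /= /r [RHS]mxtrace_mulC mulmxA cb_rb avg_mx_compl_comm.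
by rewrite -(cfRepr1 rT) char1_ge_norm ?cfRepr_char.
Qed.

(** M is a sum of N operators of Sym T on the fixed vectors. *)
Definition symOn_comb N (M : 'M[algC]_m) :=
  exists2 c : {perm X} -> nat, (\sum_(t in symOn T) c t)%N = N
    & M = \sum_(t in symOn T) (c t)%:R *: (rG t *m p).

Lemma symOn_comb0 : symOn_comb 0 0.
Proof. by exists (fun=> 0%N); rewrite big1 // => t _; rewrite scale0r. Qed.

Lemma symOn_combD N1 N2 M1 M2 :
  symOn_comb N1 M1 -> symOn_comb N2 M2 -> symOn_comb (N1 + N2) (M1 + M2).
Proof.
move=> [c1 <- ->] [c2 <- ->]; exists (fun t => c1 t + c2 t)%N; first by rewrite big_split.
by rewrite -big_split; apply: eq_bigr => t _; rewrite natrD scalerDl.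
Qed.

Lemma symOn_comb1 t : t \in symOn T -> symOn_comb 1 (rG t *m p).
Proof.
move=> tT; exists (fun s => nat_of_bool (s == t)).
  by rewrite -big_mkcondr (big_pred1 t) // => s /=; case: eqP => [->|_]; rewrite ?tT ?andbF.
rewrite (bigD1 t) //= eqxx scale1r big1 ?addr0 // => s /andP[_ /negPf->].
by rewrite scale0r.
Qed.

Lemma norm_mxtrace_comb N1 N2 M1 M2 : symOn_comb N1 M1 -> symOn_comb N2 M2 ->
  `|\tr (M1 *m M2)| <= N1%:R * N2%:R * w%:R.
Proof.
move=> [c1 <- ->] [c2 <- ->]; rewrite mulmx_suml raddf_sum /=.
rewrite !natr_sum !mulr_suml; apply: le_trans (ler_norm_sum _ _ _) _.
apply: ler_sum => s sT; rewrite mulmx_sumr raddf_sum /= mulr_sumr mulr_suml.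
apply: le_trans (ler_norm_sum _ _ _) _; apply: ler_sum => t tT.
rewrite -scalemxAl -scalemxAr scalerA mxtraceZ normrM normrM !normr_nat.
rewrite ler_wpM2l ?mulr_ge0 ?ler0n //.
rewrite mulmxA -(mulmxA (rG s)) avg_mx_compl_comm // -!mulmxA pp mulmxA -rGM.
by rewrite norm_mxtrace_fixed // groupM.
Qed.

Hypothesis avg0 : forall B, #|B| = #|A|.+1 -> avg_mx rG B = 0.

(** The transpositions (j y) represent the cosets of Sym A in Sym (j |: A), so the left-hand
    side is a multiple of the projection on the vectors fixed by Sym (j |: A), which is zero. *)
Lemma sum_tperm_avg j : j \in T -> \sum_(y in j |: A) rG (tperm j y) *m p = 0.
Proof.
move=> jT; have jA : j \notin A by rewrite inE jT.
have sAB : A \subset j |: A by apply: subsetUr.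
have : \sum_(b in symOn (j |: A)) rG b *m p = 0.
  rewrite -mulmx_suml.
  have Bc : #|j |: A| = #|A|.+1 by rewrite cardsU1 jA.
  have /eqP := avg0 Bc.
  by rewrite scaler_eq0 invr_eq0 (negPf (neq0CG _)) => /eqP ->; rewrite mul0mx.
rewrite (partition_big (fun b : {perm X} => b^-1%g j) (mem (j |: A))) /=; last first.
  by move=> b; rewrite -groupV inE => /perm_closed ->; rewrite !inE eqxx.
rewrite (eq_bigr (fun y => #|symOn A|%:R *: (rG (tperm j y) *m p))); last first.
  move=> y yB; rewrite (reindex_inj (mulgI (tperm j y))) /=.
  rewrite (eq_bigl (mem (symOn A))); last first.
    move=> a /=; apply/andP/symOnP => [[tA /eqP aj] x xA|aA].
      have {}aj : a j = j by have := permKV (tperm j y * a)%g j; rewrite aj permM tpermR.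
      have [->//|xj] := eqVneq x j.
      have xB : x \notin j |: A by rewrite !inE negb_or xj -in_setC.
      have := symOnP _ _ tA x xB; rewrite permM tpermD //.
        by rewrite eq_sym.
      by apply: contraNneq xB => <-.
    have aj : a j = j by apply: aA.
    have mulj : (tperm j y * a)%g y = j by rewrite permM tpermR.
    split; last by rewrite -{2}mulj permK.
    apply: groupM; last first.
      by apply/symOnP=> x; rewrite !inE negb_or => /andP[_ nxA]; rewrite aA // inE.
    apply/symOnP=> x xB; rewrite tpermD //; first by apply: contraNneq xB => <-; rewrite !inE eqxx.
    by apply: contraNneq xB => <-.
  rewrite (eq_bigr (fun=> rG (tperm j y) *m p)); last first.
    by move=> a aA; rewrite rGM -mulmxA avg_mxMl.
  by rewrite sumr_const scaler_nat.
rewrite -scaler_sumr => /eqP.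
by rewrite scaler_eq0 (negPf (neq0CG _)) => /eqP.
Qed.

Lemma double_coset_avg g g' : {in T, g =1 g'} -> p *m rG g *m p = p *m rG g' *m p.
Proof.
move=> eqT; have aA : (g * g'^-1)%g \in symOn A.
  by apply/symOnP=> x; rewrite inE negbK permM => /eqT ->; rewrite permK.
by rewrite -[in LHS](mulgKV g' g) rGM mulmxA avg_mxMr.
Qed.

Definition defect g := #|g @: T :\: T|.

Lemma defect0_split g : defect g = 0%N ->
  exists2 t, t \in symOn T & exists2 a, a \in symOn A & g = (t * a)%g.
Proof.
move/eqP; rewrite cards_eq0 setD_eq0 => sgT.
have gT : g @: T = T.
  by apply/eqP; rewrite eqEcard sgT card_imset ?leqnn //; apply: perm_inj.
have gX : g \in symOn [set: X] by apply/symOnP=> x; rewrite inE.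
by have := split_symOn gX gT (subsetT T); rewrite setTD.
Qed.

(** Let g send i in T to x outside T, and let j in T be missed by g.  In the vanishing sum of
    p h p over h = g (x j) (j y) for y in j |: A, the |A| - s indices y that are x or are not
    images of T give p g p, because p h p only depends on the restriction of h to T up to
    permutations of A; the other s + 1 indices have a smaller defect. *)
Lemma avg_mulmx_comb (s : nat) g : defect g = s ->
  exists2 M, symOn_comb s`! M & (#|A| ^_ s)%:R *: (p *m rG g *m p) = (-1) ^+ s *: M.
Proof.
elim: s g => [|s IHs] g def_g.
  have [t tT [a aA ->]] := defect0_split def_g.
  exists (rG t *m p); first exact: symOn_comb1.
  rewrite ffactn0 expr0 !scale1r rGM mulmxA -(mulmxA _ (rG a)) avg_mxMl //.
  by rewrite avg_mx_compl_comm // -mulmxA pp.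
have /card_gt0P[x] : (0 < #|g @: T :\: T|)%N by rewrite -/(defect g) def_g.
case/setDP => /imsetP[i iT gi] xT.
have /card_gt0P[j] : (0 < #|T :\: g @: T|)%N.
  rewrite cardsD -(card_imset (mem T) (@perm_inj _ g)) setIC -cardsD.
  by rewrite -/(defect g) def_g.
case/setDP=> jT jgT.
have xA : x \in A by rewrite inE.
pose h y := (g * tperm x j * tperm j y)%g.
(* The permutation h y sends i to y, the point of T that g sends to y, if any, to j,
   and agrees with g on the other points of T. *)
have h_i y : h y i = y by rewrite /h !permM -gi tpermL tpermL.
have tp_k k : k \in T -> k != i -> tperm x j (g k) = g k /\ j != g k.
  move=> kT ki; have jgk : j != g k by apply: contraNneq jgT => ->; apply: imset_f.
  by split; rewrite ?tpermD // gi (inj_eq perm_inj) eq_sym.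
have h_k y k : k \in T -> k != i -> g k != y -> h y k = g k.
  by move=> kT ki gky; have [tk jk] := tp_k k kT ki; rewrite /h !permM tk tpermD // eq_sym.
have h_y y k : k \in T -> k != i -> g k = y -> h y k = j.
  by move=> kT ki gky; have [tk _] := tp_k k kT ki; rewrite /h !permM tk gky tpermR.
have sum0 : \sum_(y in j |: A) p *m rG (h y) *m p = 0.
  transitivity (p *m rG (g * tperm x j)%g *m \sum_(y in j |: A) rG (tperm j y) *m p).
    by rewrite mulmx_sumr; apply: eq_bigr => y _; rewrite /h rGM !mulmxA.
  by rewrite sum_tperm_avg // mulmx0.
pose Y := (g @: T :\: T) :\ x.
have cY : #|Y| = s.
  apply/eqP; rewrite -eqSS -def_g /defect (cardsD1 x (g @: T :\: T)).
  by rewrite in_setD xT {1}gi imset_f.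
have sYA : Y \subset A by apply/subsetP=> y; rewrite !inE => /and3P[].
have sumA : \sum_(y in A) p *m rG (h y) *m p
    = (#|A| - s)%:R *: (p *m rG g *m p) + \sum_(y in Y) p *m rG (h y) *m p.
  rewrite (big_setID Y) /= (setIidPr sYA) addrC; congr (_ + _).
  rewrite (eq_bigr (fun=> p *m rG g *m p)).
    by rewrite sumr_const scaler_nat cardsD (setIidPr sYA) cY.
  move=> y /setDP[yA yY].
  have gk_y k : k \in T -> k != i -> g k != y.
    move=> kT ki; have [->|yx] := eqVneq y x; first by rewrite gi (inj_eq perm_inj).
    move: yY; rewrite !inE yx (_ : y \notin T) /=; last by rewrite -in_setC.
    by apply: contraNneq => <-; apply: imset_f.
  have -> : p *m rG g *m p = p *m rG (g * tperm x y)%g *m p.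
    rewrite rGM mulmxA -[RHS]mulmxA avg_mxMl //; apply/symOnP => z zA.
    by rewrite tpermD //; apply: contraNneq zA => <-.
  apply: double_coset_avg => k kT; have [->|ki] := eqVneq k i.
    by rewrite h_i permM -gi tpermL.
  have gky := gk_y k kT ki; rewrite h_k // permM tpermD ?(eq_sym y) //.
  by rewrite gi (inj_eq perm_inj) eq_sym.
have defect_h y : y \in j |: Y -> defect (h y) = s.
  move=> yjY; rewrite /defect -cY; congr #|pred_of_set _|; apply/setP=> z.
  apply/setDP/idP => [[/imsetP[k kT ->] hT]|].
    have [ki|ki] := eqVneq k i.
      by move: yjY hT; rewrite ki h_i => /setU1P[->|//]; rewrite jT.
    have [gky|gky] := eqVneq (g k) y; first by rewrite (h_y _ _ kT ki gky) jT in hT.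
    rewrite (h_k _ _ kT ki gky) in hT *; rewrite !inE hT imset_f //.
    by rewrite !andbT gi (inj_eq perm_inj).
  case/setD1P=> zx /setDP[/imsetP[k kT zk] zT]; split=> //.
  have ki : k != i by apply: contraNneq zx => ki; rewrite zk ki gi.
  have [gky|gky] := eqVneq (g k) y; last by rewrite zk -(h_k _ _ kT ki gky) imset_f.
  by rewrite zk gky -{1}(h_i y) imset_f.
have jA : j \notin A by rewrite inE jT.
have jY : j \notin Y by apply: contra jA; apply: subsetP.
have {sum0 sumA} key : (#|A| - s)%:R *: (p *m rG g *m p) = - \sum_(y in j |: Y) p *m rG (h y) *m p.
  apply/eqP; rewrite -addr_eq0 big_setU1 //= addrCA -sumA.
  by move: sum0; rewrite big_setU1 //= => ->.
pose R (N : nat) (Z : 'M[algC]_m) := exists2 M, symOn_comb N M & Z = (-1) ^+ s *: M.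
have [M cM defM] : R (\sum_(y in j |: Y) s`!)%N
    (\sum_(y in j |: Y) (#|A| ^_ s)%:R *: (p *m rG (h y) *m p)).
  apply: (big_ind2 R); first by exists 0; [exact: symOn_comb0 | rewrite scaler0].
    move=> N1 Z1 N2 Z2 [M1 cM1 ->] [M2 cM2 ->].
    by exists (M1 + M2); [exact: symOn_combD | rewrite scalerDr].
  by move=> y /defect_h; apply: IHs.
exists M.
  by move: cM; rewrite sum_nat_const cardsU1 jY cY factS.
rewrite ffactnSr natrM -scalerA key scalerN scaler_sumr defM exprS mulN1r scaleNr.
by [].
Qed.

(** As p g p g^-1 has the trace of (p g p)(p g^-1 p), the expansions for g and g^-1, of the same
    defect s, bound it by w s!^2 divided by the square of |A| (|A| - 1) ... (|A| - s + 1). *)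
Lemma avg0_mxtrace_le g :
  `|\tr (p *m rG g *m p *m rG g^-1%g)| <= w%:R / ('C(#|A|, defect g))%:R ^+ 2.
Proof.
set s := defect g.
have defectV : defect g^-1%g = s.
  rewrite /s /defect !cardsD !card_imset; try exact: perm_inj.
  congr (_ - _)%N; rewrite -(card_imset _ (@perm_inj _ g)) imsetI; last first.
    by move=> x y _ _; apply: perm_inj.
  by rewrite imset_permKV setIC.
have [M1 c1 e1] := avg_mulmx_comb (erefl s : defect g = s).
have [M2 c2 e2] := avg_mulmx_comb defectV.
have sA : (s <= #|A|)%N.
  by apply: subset_leq_card; apply/subsetP=> y /setDP[_ yT]; rewrite inE.
have -> : \tr (p *m rG g *m p *m rG g^-1%g) = \tr ((p *m rG g *m p) *m (p *m rG g^-1%g *m p)).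
  rewrite [in RHS]mulmxA [RHS]mxtrace_mulC !mulmxA pp.
  by rewrite -(mulmxA _ p p) pp.
have nzC : ('C(#|A|, s))%:R != 0 :> algC by rewrite pnatr_eq0 -lt0n bin_gt0.
have nzs : (s`!)%:R != 0 :> algC by rewrite pnatr_eq0 -lt0n fact_gt0.
set Z1 := p *m rG g *m p in e1 *; set Z2 := p *m _ *m p in e2 *.
have := norm_mxtrace_comb c1 c2.
have -> : \tr (M1 *m M2) = (#|A| ^_ s)%:R ^+ 2 * \tr (Z1 *m Z2).
  rewrite expr2 -mxtraceZ -scalerA scalemxAr e2 scalemxAl e1 -scalemxAr -scalemxAl scalerA.
  by rewrite -expr2 sqrr_sign scale1r.
rewrite -bin_ffact natrM normrM normrX normrM !normr_nat.
set t := `|_| => le_t; rewrite ler_pdivlMr; last by rewrite exprn_gt0 // lt0r nzC ler0n.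
rewrite -(@ler_pM2r _ ((s`!)%:R ^+ 2)); last by rewrite exprn_gt0 // lt0r nzs ler0n.
by apply: etrans le_t; congr (_ <= _); ring.
Qed.

(** Grouping by the image U of T and then by V = U :&: T: there are C(|A|, k) sets U for given
    V, with k = |T| - |V|, so that each of the 2^|T| sets V contributes at most 1. *)
Lemma sum_defect : \sum_(g in ('Sym_X)%g) (('C(#|A|, defect g))%:R ^+ 2)^-1
   <= (2 ^ #|T| * #|stab T|)%:R :> algC.
Proof.
pose f U : algC := (('C(#|A|, #|U :\: T|))%:R ^+ 2)^-1.
have f_ge0 U : 0 <= f U by rewrite invr_ge0 exprn_ge0.
have -> : \sum_(g in ('Sym_X)%g) (('C(#|A|, defect g))%:R ^+ 2)^-1 = \sum_(g : {perm X}) f (g @: T).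
  by apply: eq_bigl => g; rewrite inE.
rewrite (partition_big (fun g : {perm X} => g @: T) (fun U => #|U| == #|T|)) /=; last first.
  by move=> g _; rewrite card_imset //; apply: perm_inj.
apply: (@le_trans _ _ (\sum_(U : {set X} | #|U| == #|T|) #|stab T|%:R * f U)).
  apply: ler_sum => U _; rewrite (eq_bigr (fun=> f U)); last by move=> g /eqP->.
  pose F := [set g : {perm X} | g @: T == U].
  rewrite (eq_bigl (fun g => g \in F)); last by move=> g; rewrite inE.
  rewrite sumr_const -[leLHS]mulr_natl ler_wpM2r // ler_nat.
  have [->|[g0]] := set_0Vmem F; rewrite ?cards0 // inE => /eqP g0T.
  rewrite -(card_imset F (mulIg g0^-1%g)); apply: subset_leq_card.
  apply/subsetP => _ /imsetP[g + ->]; rewrite inE => /eqP gT.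
  by rewrite astabs_imset imset_mulp gT -g0T imset_permK.
rewrite -mulr_sumr natrM mulrC ler_wpM2r ?ler0n //.
rewrite (partition_big (fun U : {set X} => U :&: T) (mem (powerset T))) /=; last first.
  by move=> U _; rewrite inE subsetIr.
rewrite -card_powerset -sumr_const; apply: ler_sum => V VT; rewrite inE in VT.
set k := (#|T| - #|V|)%N.
have cU U : (#|U| == #|T|) && (U :&: T == V) -> #|U :\: T| = k.
  by move=> /andP[/eqP cU /eqP UV]; rewrite cardsD UV cU.
rewrite (eq_bigr (fun=> (('C(#|A|, k))%:R ^+ 2)^-1)); last by move=> U /cU; rewrite /f => ->.
pose F := [set U : {set X} | (#|U| == #|T|) && (U :&: T == V)].
rewrite (eq_bigl (fun U => U \in F)); last by move=> U; rewrite inE.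
rewrite sumr_const -[leLHS]mulr_natl.
have [->|nzC] := eqVneq 'C(#|A|, k) 0%N; first by rewrite expr0n invr0 mulr0.
rewrite ler_pdivrMr ?exprn_gt0 ?ltr0n ?lt0n // mul1r expr2 -natrM ler_nat.
apply: leq_trans (leq_pmull _ _); last by rewrite lt0n.
have injF : {in F &, injective (fun U : {set X} => U :\: T)}.
  move=> U1 U2 /[!inE] /andP[_ /eqP e1] /andP[_ /eqP e2] e.
  by rewrite -(setID U1 T) -(setID U2 T) e1 e2 e.
rewrite -(card_in_imset injF) -cards_draws; apply: subset_leq_card.
apply/subsetP=> _ /imsetP[U UF ->]; rewrite inE in UF; rewrite inE (cU _ UF) eqxx andbT.
by apply/subsetP=> x; rewrite !inE => /andP[].
Qed.

(** By Schur's lemma the sum of the conjugates of p is the scalar |G| w / m. *)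
Lemma degree_lower_bound : mx_irreducible rG ->
  ('C(#|X|, #|T|) * w <= 2 ^ #|T| * m)%N.
Proof.
move=> irrG; pose Z := \sum_(g in ('Sym_X)%g) rG g *m p *m rG g^-1%g.
have cZ : centgmx rG Z.
  apply/centgmxP=> h _; rewrite mulmx_suml mulmx_sumr.
  rewrite [RHS](reindex_inj (mulgI h^-1%g)) /=; apply: eq_big => [g|g _]; first by rewrite !inE.
  by rewrite !mulmxA -rGM mulKVg invMg invgK rGM !mulmxA.
have [z defZ] : exists z, Z = z%:M.
  apply/is_scalar_mxP; apply: mx_abs_irr_cent_scalar cZ.
  exact: group_closure_closed_field.
have trZ : z * m%:R = #|('Sym_X)%g|%:R * w%:R.
  rewrite mulr_natr -mxtrace_scalar -defZ /Z raddf_sum /=.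
  rewrite (eq_bigr (fun=> w%:R)); first by rewrite sumr_const mulr_natl.
  by move=> g _; rewrite mxtrace_mulC mulmxA -rGM mulVg repr_mx1 mul1mx mxtrace_idem.
have trpZ : z * w%:R = \sum_(g in ('Sym_X)%g) \tr (p *m rG g *m p *m rG g^-1%g).
  rewrite -(mxtrace_idem pp) -mxtraceZ -mul_scalar_mx -scalar_mxC -defZ /Z mulmx_sumr raddf_sum.
  by apply: eq_bigr => g _; rewrite !mulmxA.
have m_gt0 : (0 < m)%N by case/mx_irrP: irrG.
have [->|w_gt0] := posnP w; first by rewrite muln0.
have le_zw : z * w%:R <= w%:R * (2 ^ #|T| * #|stab T|)%:R.
  have z_ge0 : 0 <= z.
    by rewrite -(pmulr_lge0 _ (_ : 0 < m%:R)) ?ltr0n // trZ mulr_ge0 ?ler0n.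
  rewrite -[leLHS]ger0_norm ?mulr_ge0 ?ler0n // trpZ; apply: le_trans (ler_norm_sum _ _ _) _.
  apply: le_trans (_ : _ <= w%:R * _) (ler_wpM2l _ sum_defect); rewrite ?ler0n // mulr_sumr.
  by apply: ler_sum => g _; apply: avg0_mxtrace_le.
move: le_zw; rewrite mulrC ler_pM2l ?ltr0n // => /(ler_wpM2r (ler0n _ m)).
rewrite trZ (card_Sym_bin T) -!natrM ler_nat.
rewrite mulnAC [X in (_ <= X)%N]mulnAC leq_pmul2r ?cardG_gt0 //.
Qed.

End LowerBound.

(** * Rows and columns of a tableau *)

Section Tableau.
Variables (n : nat) (lambda : intpart n).
Implicit Types (i j x y : 'I_n) (g s t : 'S_n) (A B : {set 'I_n}).

Notation row := (tab_row lambda).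
Notation col := (tab_col lambda).
Notation rowlen r := (nth 0%N lambda r).

Lemma sumn_intpart : sumn lambda = n.
Proof. by have /and3P[_ _ /eqP] := intpartP lambda. Qed.

Let lt_sumn i : (i < sumn lambda)%N. Proof. by rewrite sumn_intpart. Qed.

Lemma tab_row_lt i : (row i < size lambda)%N.
Proof. exact: reshape_indexP. Qed.

Lemma tab_col_lt_row i : (col i < rowlen (row i))%N.
Proof. exact: reshape_offsetP. Qed.

Lemma tab_inj i j : row i = row j -> col i = col j -> i = j.
Proof.
rewrite /tab_row /tab_col => er ec; apply: val_inj.
by rewrite /= -(reshape_indexK lambda i) er ec reshape_indexK.
Qed.

Lemma tab_cell r c : (c < rowlen r)%N -> {i | row i = r & col i = c}.
Proof.
move=> cr; have lt_n : (flatten_index lambda r c < n)%N.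
  by rewrite -[X in (_ < X)%N]sumn_intpart flatten_indexP.
by exists (Ordinal lt_n); [exact: flatten_indexKl | exact: flatten_indexKr].
Qed.

Lemma rowlen_le_head r : (rowlen r <= head 0%N lambda)%N.
Proof.
have [sorted_l _ _] := and3P (intpartP lambda); rewrite -nth0.
have [rs|sr] := ltnP r (size lambda); last by rewrite nth_default.
have geq_trans (y x z : nat) (yx : (y <= x)%N) (zy : (z <= y)%N) := leq_trans zy yx.
have := @sorted_leq_nth _ geq geq_trans leqnn 0%N _ sorted_l.
by move/(_ 0%N r); apply; rewrite // inE (leq_ltn_trans _ rs).
Qed.

Lemma tab_col_lt i : (col i < head 0%N lambda)%N.
Proof. exact: leq_trans (tab_col_lt_row i) (rowlen_le_head _). Qed.

Lemma rowlen_gt0 r : (r < size lambda)%N -> (0 < rowlen r)%N.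
Proof.
have [_ nz _] := and3P (intpartP lambda) => rs; rewrite lt0n.
by apply: contraNneq nz => <-; apply: mem_nth.
Qed.

Lemma card_tab_row r : #|[set i | row i == r]| = rowlen r.
Proof.
pose cell (c : 'I_(rowlen r)) := s2val (tab_cell (ltn_ord c)).
have cellr c : row (cell c) = r by rewrite /cell; case: (tab_cell _).
have cellc c : col (cell c) = c by rewrite /cell; case: (tab_cell _).
have inj : injective cell by move=> c c' /(congr1 col); rewrite !cellc => /val_inj.
rewrite -[RHS]card_ord -(card_imset predT inj); apply: eq_card => i.
apply/idP/imsetP => [|[c _ ->]]; rewrite inE; last by rewrite cellr.
move=> /eqP ir; have cr : (col i < rowlen r)%N by rewrite -ir tab_col_lt_row.
by exists (Ordinal cr) => //; apply: tab_inj; rewrite ?cellr ?cellc.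
Qed.

Lemma card_tab_col0 : #|[set i | col i == 0%N]| = size lambda.
Proof.
pose cell (r : 'I_(size lambda)) := s2val (tab_cell (rowlen_gt0 (ltn_ord r))).
have cellr r : row (cell r) = r by rewrite /cell; case: (tab_cell _).
have cellc r : col (cell r) = 0%N by rewrite /cell; case: (tab_cell _).
have inj : injective cell by move=> c c' /(congr1 row); rewrite !cellr => /val_inj.
rewrite -[RHS]card_ord -(card_imset predT inj); apply: eq_card => i.
apply/idP/imsetP => [|[c _ ->]]; rewrite inE; last by rewrite cellc.
move=> /eqP ic; exists (Ordinal (tab_row_lt i)) => //.
by apply: tab_inj; rewrite ?cellr ?cellc.
Qed.

(** At most min(k, rowlen r) entries of row r can be sent to distinct columns smaller than k,
    and the identity reaches this bound. *)
Lemma card_row_col_lt_le g r k : (forall i j, row i = row j -> col (g i) = col (g j) -> i = j) ->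
  (#|[set i | (row i == r) && (col (g i) < k)%N]|
     <= #|[set i | (row i == r) && (col i < k)%N]|)%N.
Proof.
move=> injg; have [rk|kr] := leqP (rowlen r) k.
  apply: subset_leq_card; apply/subsetP=> i; rewrite !inE => /andP[/eqP ir _].
  by rewrite ir eqxx (leq_trans (tab_col_lt_row i)) // ir.
apply: (@leq_trans k).
  case: k kr => [|k] kr; first by rewrite leqn0 cards_eq0; apply/eqP/setP=> i; rewrite !inE andbF.
  rewrite -[X in (_ <= X)%N]card_ord -(card_in_imset (f := fun i => inord (col (g i)) : 'I_k.+1)).
    exact: max_card.
  move=> i j; rewrite !inE => /andP[/eqP ir ik] /andP[/eqP jr jk] /(congr1 val).
  by rewrite /= !inordK //; apply: injg; rewrite ir jr.
pose cell (c : 'I_k) := s2val (tab_cell (ltn_trans (ltn_ord c) kr)).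
have cellr c : row (cell c) = r by rewrite /cell; case: (tab_cell _).
have cellc c : col (cell c) = c by rewrite /cell; case: (tab_cell _).
have inj : injective cell by move=> c c' /(congr1 col); rewrite !cellc => /val_inj.
rewrite -[X in (X <= _)%N]card_ord -(card_imset predT inj); apply: subset_leq_card.
by apply/subsetP=> _ /imsetP[c _ ->]; rewrite inE cellr cellc eqxx ltn_ord.
Qed.

(** The number of entries sent to columns smaller than k does not depend on the permutation g,
    so the row by row inequalities are equalities.  Taking for k the length of a row, all the
    entries of that row stay in the columns it meets. *)
Lemma tab_col_perm_lt g : (forall i j, row i = row j -> col (g i) = col (g j) -> i = j) ->
  forall i, (col (g i) < rowlen (row i))%N.
Proof.
move=> injg i; set k := rowlen (row i).
pose N r := #|[set j | (row j == r) && (col (g j) < k)%N]|.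
pose M r := #|[set j | (row j == r) && (col j < k)%N]|.
have NM r : (N r <= M r)%N by apply: card_row_col_lt_le.
have sumE (f : 'I_n -> nat) : (\sum_(r < size lambda) #|[set j | (row j == r) && (f j < k)%N]|
    = #|[set j | (f j < k)%N]|)%N.
  rewrite -[RHS]sum1_card (partition_big (fun j => Ordinal (tab_row_lt j)) predT) //=.
  apply: eq_bigr => r _; rewrite -sum1_card; apply: eq_bigl => j.
  by rewrite !inE -val_eqE andbC.
have sumNM : (\sum_(r < size lambda) N r = \sum_(r < size lambda) M r)%N.
  rewrite !sumE -(card_imset _ (@perm_inj _ g)); apply: eq_card => j.
  rewrite inE; apply/imsetP/idP => [[j']|jk]; first by rewrite inE => ? ->.
  by exists (g^-1%g j); rewrite ?inE permKV.
have eqNM : N (row i) = M (row i).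
  have [_] := @leqif_sum _ predT (fun r : 'I_(size lambda) => M r <= N r)%N
    (fun r => N r) (fun r => M r) (fun r _ => leqif_geq (NM r)).
  rewrite sumNM eqxx => /esym/forallP/(_ (Ordinal (tab_row_lt i))) /= Mi.
  by apply/eqP; rewrite eqn_leq NM.
have /eqP : [set j | (row j == row i) && (col (g j) < k)%N] == [set j | row j == row i].
  rewrite eqEcard -[X in (_ <= X)%N]/(N (row i)) eqNM subset_leq_card; last first.
    apply/subsetP=> j; rewrite !inE => /eqP ji; rewrite ji eqxx /=.
    by rewrite /k -ji tab_col_lt_row.
  by rewrite andbT; apply/subsetP=> j; rewrite !inE => /andP[].
by move/setP/(_ i); rewrite !inE eqxx /=.
Qed.

(** The row permutation p sends each entry to the cell of its row in the column where g sends it,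
    a cell that exists by tab_col_perm_lt. *)
Lemma row_col_factor g : (forall i j, row i = row j -> col (g i) = col (g j) -> i = j) ->
  exists2 p, p \in row_stab lambda & exists2 q, q \in col_stab lambda & g = (p * q)%g.
Proof.
move=> injg; pose pf i := s2val (tab_cell (tab_col_perm_lt injg i)).
have pr i : row (pf i) = row i by rewrite /pf; case: (tab_cell _).
have pc i : col (pf i) = col (g i) by rewrite /pf; case: (tab_cell _).
have pinj : injective pf.
  move=> i j eq_p; apply: (injg i j); first by rewrite -(pr i) eq_p pr.
  by rewrite -(pc i) eq_p pc.
exists (perm pinj); first by rewrite inE; apply/forallP=> i; rewrite permE pr.
exists ((perm pinj)^-1 * g)%g; last by rewrite mulKVg.
rewrite inE; apply/forallP=> i; rewrite permM -pc -[pf _](permE pinj) permKV.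
by [].
Qed.

Lemma row_stab_group : group_set (row_stab lambda).
Proof.
apply/group_setP; split=> [|s t]; rewrite !inE; first by apply/forallP=> i; rewrite perm1.
move=> /forallP sr /forallP tr; apply/forallP=> i.
by rewrite permM (eqP (tr _)) sr.
Qed.

Lemma col_stab_group : group_set (col_stab lambda).
Proof.
apply/group_setP; split=> [|s t]; rewrite !inE; first by apply/forallP=> i; rewrite perm1.
move=> /forallP sr /forallP tr; apply/forallP=> i.
by rewrite permM (eqP (tr _)) sr.
Qed.

Lemma row_col_stab1 s : s \in row_stab lambda -> s \in col_stab lambda -> s = 1%g.
Proof.
rewrite !inE => /forallP sr /forallP sc; apply/permP=> i; rewrite perm1.
by apply: tab_inj; apply/eqP.
Qed.

Lemma tperm_row_stab i j : row i = row j -> tperm i j \in row_stab lambda.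
Proof. by move=> ij; rewrite inE; apply/forallP=> k; case: tpermP => [->|->|//]; rewrite ij. Qed.

Lemma tperm_col_stab i j : col i = col j -> tperm i j \in col_stab lambda.
Proof. by move=> ij; rewrite inE; apply/forallP=> k; case: tpermP => [->|->|//]; rewrite ij. Qed.

Lemma symOn_row0 : symOn [set i | row i == 0%N] \subset row_stab lambda.
Proof.
apply/subsetP=> s sA; rewrite inE; apply/forallP=> i.
have [iA|iA] := boolP (i \in [set i | row i == 0%N]).
  have := iA; move: sA; rewrite inE => /perm_closed <-; rewrite !inE in iA *.
  by rewrite (eqP iA).
by rewrite (symOnP _ _ sA).
Qed.

Lemma symOn_col0 : symOn [set i | col i == 0%N] \subset col_stab lambda.
Proof.
apply/subsetP=> s sA; rewrite inE; apply/forallP=> i.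
have [iA|iA] := boolP (i \in [set i | col i == 0%N]).
  have := iA; move: sA; rewrite inE => /perm_closed <-; rewrite !inE in iA *.
  by rewrite (eqP iA).
by rewrite (symOnP _ _ sA).
Qed.

Lemma pigeonhole_lt (B : {set 'I_n}) (f : 'I_n -> nat) k :
  (forall i, (f i < k)%N) -> (k < #|B|)%N -> exists i j, [/\ i \in B, j \in B, i != j & f i = f j].
Proof.
move=> fk kB; pose F i := Ordinal (fk i).
have : ~~ [forall i in B, forall j in B, (F i == F j) ==> (i == j)].
  apply: contraTN kB => /forall_inP injF; rewrite -leqNgt -[X in (_ <= X)%N]card_ord.
  rewrite -(card_in_imset (f := F)) ?max_card // => i j iB jB Fij.
  by have /forall_inP/(_ j jB) := injF i iB; rewrite Fij eqxx => /eqP.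
rewrite negb_forall_in => /exists_inP[i iB]; rewrite negb_forall_in => /exists_inP[j jB].
rewrite negb_imply => /andP[/eqP/(congr1 val) /= fij ij].
by exists i, j.
Qed.

End Tableau.

(** * Specht modules *)

Definition adj_mx m n (M : 'M[algC]_(m, n)) : 'M[algC]_(n, m) := map_mx Num.conj (M^T).

Lemma adj_mxM m n p (M : 'M[algC]_(m, n)) (N : 'M[algC]_(n, p)) :
  adj_mx (M *m N) = adj_mx N *m adj_mx M.
Proof. by rewrite /adj_mx trmx_mul map_mxM. Qed.

Lemma adj_mxK m n (M : 'M[algC]_(m, n)) : adj_mx (adj_mx M) = M.
Proof. by apply/matrixP=> i j; rewrite !mxE conjCK. Qed.

Lemma adj_mxZ m n c (M : 'M[algC]_(m, n)) : adj_mx (c *: M) = Num.conj c *: adj_mx M.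
Proof. by apply/matrixP=> i j; rewrite !mxE rmorphM. Qed.

Lemma adj_mx_sum m n (I : finType) (P : pred I) (F : I -> 'M[algC]_(m, n)) :
  adj_mx (\sum_(i | P i) F i) = \sum_(i | P i) adj_mx (F i).
Proof. by rewrite /adj_mx !raddf_sum. Qed.

(** The diagonal entries of the product are the squared norms of the rows. *)
Lemma mulmx_adj_eq0 m n (M : 'M[algC]_(m, n)) : M *m adj_mx M = 0 -> M = 0.
Proof.
move=> MM; apply/matrixP=> i j; have /eqP := congr1 (fun N : 'M_m => N i i) MM.
rewrite !mxE psumr_eq0 => [/allP/(_ j)|k _]; last by rewrite !mxE mul_conjC_ge0.
by rewrite mem_index_enum !mxE mul_conjC_eq0 => /(_ isT)/eqP.
Qed.

Section Twist.
Variables (X : finType) (m : nat) (rG : mx_representation algC 'Sym_X m) (b : bool).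

Definition sign_twist (s : {perm X}) : 'M[algC]_m := (-1) ^+ (b && odd_perm s) *: rG s.

Lemma sign_twist_repr : mx_repr 'Sym_X sign_twist.
Proof.
split=> [|s t sG tG]; first by rewrite /sign_twist odd_perm1 andbF scale1r repr_mx1.
rewrite /sign_twist repr_mxM // -scalemxAl -scalemxAr scalerA -signr_addb; congr (_ ^+ _ *: _).
by rewrite odd_permM; case: b.
Qed.
Definition twist_repr := MxRepresentation sign_twist_repr.

Lemma twist_irr : mx_irreducible rG -> mx_irreducible twist_repr.
Proof.
move=> /mx_irrP[m_gt0 irrG]; apply/mx_irrP; split=> // U modU; apply: irrG.
apply/mxmoduleP=> s sG; have /mxmoduleP/(_ s sG) := modU.
rewrite /= /sign_twist -scalemxAr; apply: submx_trans.
by rewrite eqmx_scale // signr_eq0.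
Qed.

Lemma norm_cfRepr_twist s : `|cfRepr twist_repr s| = `|cfRepr rG s|.
Proof.
rewrite !cfunE /= /sign_twist; case: (s \in _); last by rewrite !mulr0n.
by rewrite !mulr1n mxtraceZ normrM normr_sign mul1r.
Qed.

End Twist.

Section Specht.
Variables (n : nat) (lambda : intpart n).
Implicit Types (i j : 'I_n) (g s t : 'S_n) (A B : {set 'I_n}).

Notation aG := (Sym_regular n).
Notation E := (enveloping_algebra_mx aG).
Notation R := (row_stab lambda).
Notation C := (col_stab lambda).
Notation U := (specht lambda).
Notation N := #|'Sym_('I_n)|%g.

Let aGM s t : aG (s * t)%g = aG s *m aG t.
Proof. by rewrite repr_mxM ?inE. Qed.

Definition row_sum : 'M[algC]_N := \sum_(p in R) aG p.
Definition col_sum : 'M[algC]_N := \sum_(q in C) (-1) ^+ odd_perm q *: aG q.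
Let Y := row_sum *m col_sum.

Let Rg := Group (row_stab_group lambda).
Let Cg := Group (col_stab_group lambda).

Lemma row_sumMl p : p \in R -> aG p *m row_sum = row_sum.
Proof.
move=> pR; have pRg : p \in Rg by [].
rewrite mulmx_sumr [RHS](reindex_inj (mulgI p)) /=.
by apply: eq_big => [s|s _]; rewrite ?aGM // (groupMl _ pRg).
Qed.

Lemma row_sumMr p : p \in R -> row_sum *m aG p = row_sum.
Proof.
move=> pR; have pRg : p \in Rg by [].
rewrite mulmx_suml [RHS](reindex_inj (mulIg p)) /=.
by apply: eq_big => [s|s _]; rewrite ?aGM // (groupMr _ pRg).
Qed.

Lemma col_sumMl q : q \in C -> aG q *m col_sum = (-1) ^+ odd_perm q *: col_sum.
Proof.
move=> qC; have qCg : q \in Cg by [].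
rewrite mulmx_sumr [col_sum](reindex_inj (mulgI q)) /= scaler_sumr.
apply: eq_big => [s|s _]; first by rewrite (groupMl _ qCg).
by rewrite aGM -scalemxAr scalerA odd_permM -signr_addb addbA addbb.
Qed.

Lemma col_sumMr q : q \in C -> col_sum *m aG q = (-1) ^+ odd_perm q *: col_sum.
Proof.
move=> qC; have qCg : q \in Cg by [].
rewrite mulmx_suml [col_sum in RHS](reindex_inj (mulIg q)) /= scaler_sumr.
apply: eq_big => [s|s _]; first by rewrite (groupMr _ qCg).
by rewrite aGM -scalemxAl scalerA odd_permM -signr_addb addbC -addbA addbb addbF.
Qed.

Lemma row_sum_sqr : row_sum *m row_sum = #|R|%:R *: row_sum.
Proof.
rewrite {1}/row_sum mulmx_suml; under eq_bigr => p pR do rewrite row_sumMl //.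
by rewrite sumr_const scaler_nat.
Qed.

Lemma col_sum_sqr : col_sum *m col_sum = #|C|%:R *: col_sum.
Proof.
rewrite {1}/col_sum mulmx_suml.
under eq_bigr => q qC do rewrite -scalemxAl col_sumMl // scalerA -expr2 sqrr_sign scale1r.
by rewrite sumr_const scaler_nat.
Qed.

(** Permutation matrices are unitary. *)
Lemma adj_regular g : adj_mx (aG g) = aG g^-1%g.
Proof.
apply/matrixP=> i j; rewrite !mxE !eqxx /= rmorph_nat; congr (nat_of_bool _)%:R.
by apply/eqP/eqP => ->; rewrite gring_indexK ?inE // ?mulgK ?mulgKV gring_valK.
Qed.

Lemma adj_row_sum : adj_mx row_sum = row_sum.
Proof.
rewrite adj_mx_sum; under eq_bigr => p _ do rewrite adj_regular.
rewrite [LHS](reindex_inj invg_inj) /=; apply: eq_big => [p|p _]; last by rewrite invgK.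
exact: (groupV Rg).
Qed.

Lemma adj_col_sum : adj_mx col_sum = col_sum.
Proof.
rewrite adj_mx_sum; under eq_bigr => q _ do rewrite adj_mxZ adj_regular rmorph_sign.
rewrite [LHS](reindex_inj invg_inj) /=; apply: eq_big => [q|q _]; last by rewrite invgK odd_permV.
exact: (groupV Cg).
Qed.

Lemma adj_envelop M : (M \in E)%MS -> (adj_mx M \in E)%MS.
Proof.
move=> /envelop_mxP[c ->]; rewrite adj_mx_sum.
rewrite linear_sum summx_sub // => s _; rewrite adj_mxZ adj_regular linearZ.
by rewrite scalemx_sub // envelop_mx_id ?inE.
Qed.

Lemma row_sum_envelop : (row_sum \in E)%MS.
Proof. by rewrite linear_sum summx_sub // => s _; rewrite envelop_mx_id ?inE. Qed.

Lemma col_sum_envelop : (col_sum \in E)%MS.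
Proof.
rewrite linear_sum summx_sub // => s _.
by rewrite linearZ scalemx_sub // envelop_mx_id ?inE.
Qed.

Lemma young_envelop : (Y \in E)%MS.
Proof. exact: envelop_mxM row_sum_envelop col_sum_envelop. Qed.

Lemma gring_row_regular g : gring_row (aG g) = delta_mx 0 (gring_index 'Sym_('I_n)%G g).
Proof. by rewrite /gring_row rowK gring_indexK ?inE // mul1g. Qed.

Lemma young_gring_row : young_symmetrizer lambda = gring_row Y.
Proof.
rewrite /Y mulmx_suml raddf_sum; apply: eq_bigr => p _.
rewrite mulmx_sumr raddf_sum; apply: eq_bigr => q _.
by rewrite -scalemxAr /= linearZ /= -aGM gring_row_regular.
Qed.

Lemma gring_row_eq0 M : (M \in E)%MS -> gring_row M = 0 -> M = 0.
Proof. by move=> ME M0; rewrite -(gring_rowK ME) M0 raddf0. Qed.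

(** Since only the identity preserves rows and columns, the coefficient of 1 in a b is 1. *)
Lemma young_neq0 : Y != 0.
Proof.
apply/eqP => Y0; have := congr1 (gring_proj 1%g) Y0; rewrite raddf0.
rewrite /Y mulmx_suml raddf_sum (bigD1 1%g) ?(group1 Rg) //= big1 ?addr0; last first.
  move=> p /andP[pR p1]; rewrite mulmx_sumr raddf_sum big1 // => q qC.
  rewrite -scalemxAr /= linearZ /= -aGM gring_projE ?inE //.
  case: eqP => [pq|]; last by rewrite scaler0.
  have /row_col_stab1 p_1 := pR; rewrite p_1 ?eqxx // in p1.
  by rewrite (_ : p = q^-1%g) ?(groupV Cg) //; apply/eqP; rewrite eq_mulgV1 invgK -pq.
rewrite mulmx_sumr raddf_sum (bigD1 1%g) ?(group1 Cg) //= big1 ?addr0; last first.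
  move=> q /andP[_ q1]; rewrite -scalemxAr /= linearZ /= -aGM gring_projE ?inE //.
  by rewrite mul1g eq_sym (negPf q1) scaler0.
rewrite odd_perm1 scale1r -aGM gring_projE ?inE // mul1g eqxx => /eqP.
by rewrite oner_eq0.
Qed.

(** If g sends two entries of a row to the same column, the transposition of these entries shows
    that a g b is its own opposite; otherwise g is a row permutation followed by a column
    permutation, which a and b absorb. *)
Lemma sandwich M : (M \in E)%MS -> exists c, row_sum *m M *m col_sum = c *: Y.
Proof.
have key g : exists c, row_sum *m aG g *m col_sum = c *: Y.
  have [/existsP[i /existsP[j /and3P[ij /eqP rij /eqP cij]]]|nex] :=
    boolP [exists i, exists j, [&& i != j, tab_row lambda i == tab_row lambda j
                              & tab_col lambda (g i) == tab_col lambda (g j)]].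
    exists 0; rewrite scale0r; set Z := row_sum *m _ *m _.
    have ZN : Z = - Z.
      rewrite {1}/Z -(row_sumMr (tperm_row_stab rij)) -[row_sum *m _ *m _]mulmxA -aGM.
      have -> : (tperm i j * g = g * tperm (g i) (g j))%g by rewrite -tpermJ conjgE mulKVg.
      rewrite aGM mulmxA -[in LHS]mulmxA (col_sumMl (tperm_col_stab cij)).
      by rewrite odd_tperm (inj_eq perm_inj) ij expr1 scaleN1r mulmxN.
    apply/eqP; have /eqP := ZN; rewrite -addr_eq0 -mulr2n -scaler_nat scaler_eq0.
    by rewrite pnatr_eq0.
  have [|p pR [q qC ->]] := @row_col_factor n lambda g.
    move=> i j rij cij; apply/eqP/negP => /negP ij; case/negP: nex.
    by apply/existsP; exists i; apply/existsP; exists j; rewrite ij rij cij !eqxx.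
  exists ((-1) ^+ odd_perm q).
  by rewrite aGM mulmxA row_sumMr // -mulmxA col_sumMl // -scalemxAr.
have /fin_all_exists[c cE] := key.
move=> /envelop_mxP[a ->]; exists (\sum_(g in ('Sym_('I_n))%g) a g * c g).
(* The sums a and b are abstracted so that only the sum over g is distributed. *)
move: cE; rewrite /Y; move: (row_sum *m col_sum) row_sum col_sum => y r d cE.
rewrite mulmx_sumr mulmx_suml scaler_suml; apply: eq_bigr => g _.
by rewrite -scalemxAr -scalemxAl cE scalerA.
Qed.

Lemma spechtP (v : 'rV_N) : reflect (exists2 W, (W \in E)%MS & v = gring_row (Y *m W)) (v <= U)%MS.
Proof.
apply: (iffP cyclic_mxP) => -[W WE ->]; exists W => //; by rewrite young_gring_row -gring_row_mul.
Qed.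

Lemma gring_row_neq0 (M : 'M_N) (v : 'rV[algC]_N) :
  (M \in E)%MS -> v = gring_row M -> v != 0 -> M != 0.
Proof. by move=> ME -> ; apply: contraNneq => ->; rewrite raddf0. Qed.

(** A nonzero submodule contains a nonzero x = a b W.  With y the adjoint of x, the element x y a b
    lies in the submodule and in the line of a b, by sandwich.  If it vanished, so would x y x,
    hence x y x y, the product of x y and its adjoint, then x y and x; so the submodule contains a b. *)
Lemma specht_simple : mxsimple aG U.
Proof.
split; first exact: specht_module.
  rewrite cyclic_mx_eq0 young_gring_row; apply: contra_neq young_neq0.
  exact: gring_row_eq0 young_envelop.
move=> V modV sVU nzV; apply: cyclic_mx_sub => //.
have nzv : nz_row V != 0 by rewrite nz_row_eq0.
have /spechtP[W WE def_v] := submx_trans (nz_row_sub V) sVU.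
set M := Y *m W in def_v; have ME : (M \in E)%MS by rewrite envelop_mxM ?young_envelop.
have nzM : M != 0 := gring_row_neq0 ME def_v nzv.
have aE := adj_envelop ME.
have [c cE] : exists c, M *m adj_mx M *m Y = c *: Y.
  have [|c cE] := @sandwich (col_sum *m W *m adj_mx M *m row_sum).
    by rewrite !envelop_mxM ?col_sum_envelop ?row_sum_envelop.
  by exists c; rewrite -cE /M /Y !mulmxA.
have nzc : c != 0.
  apply: contra_neq nzM => c0; apply: mulmx_adj_eq0; apply: mulmx_adj_eq0.
  have MMM : M *m adj_mx M *m M = 0.
    by transitivity (M *m adj_mx M *m (Y *m W)) => //; rewrite mulmxA cE c0 scale0r mul0mx.
  by rewrite adj_mxM adj_mxK mulmxA MMM mul0mx.
have : (gring_row (M *m adj_mx M *m Y) <= V)%MS.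
  have -> : gring_row (M *m adj_mx M *m Y) = nz_row V *m (adj_mx M *m Y).
    by rewrite def_v -gring_row_mul; congr gring_row; rewrite -[LHS]mulmxA.
  rewrite (mxmodule_envelop modV) ?nz_row_sub //.
  by rewrite envelop_mxM ?young_envelop.
by rewrite cE linearZ /= eqmx_scale // young_gring_row.
Qed.

Lemma specht_irr : mx_irreducible (specht_repr lambda).
Proof. exact/submod_mx_irr/specht_simple. Qed.

Lemma chi_irr : chi lambda \in irr 'Sym_('I_n).
Proof.
by apply/irr_reprP; exists (Representation (specht_repr lambda)) => //; apply: specht_irr.
Qed.

Notation sgnV b := (fun s : 'S_n => (-1) ^+ (b && odd_perm s) : algC).

Lemma avg_specht_neq0 b A (v : 'rV_N) : v != 0 -> (v <= U)%MS ->
  (forall a, a \in symOn A -> v *m aG a = sgnV b a *: v) ->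
  avg_mx (twist_repr (specht_repr lambda) b) A != 0.
Proof.
move=> nzv vU va; set x := in_submod U v.
have nzx : x != 0 by apply: contra_neq nzv => x0; rewrite -(in_submodK vU) -/x x0 linear0.
have xavg : x *m avg_mx (twist_repr (specht_repr lambda) b) A = x.
  rewrite /avg_mx -scalemxAr mulmx_sumr (eq_bigr (fun=> x)); last first.
    move=> a aA; rewrite /= /sign_twist -scalemxAr /= -in_submodJ //.
    by rewrite va // linearZ /= scalerA -expr2 sqrr_sign scale1r.
  by rewrite sumr_const -scaler_nat scalerA mulVf ?scale1r ?neq0CG.
by apply: contra_neq nzx => avg0; rewrite -xavg avg0 mulmx0.
Qed.

Lemma avg_specht_eq0 b B :
  (forall W, (W \in E)%MS -> Y *m W *m \sum_(s in symOn B) sgnV b s *: aG s = 0) ->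
  avg_mx (twist_repr (specht_repr lambda) b) B = 0.
Proof.
move=> YW0; rewrite /avg_mx; set S := \sum_(s in symOn B) _.
suffices -> : S = 0 by rewrite scaler0.
rewrite -(val_submodK S) -[RHS](raddf0 (in_submod U)); congr in_submod.
rewrite -[S]mul1mx mulmx_sumr raddf_sum /=.
rewrite (eq_bigr (fun s => val_submod 1%:M *m (sgnV b s *: aG s))); last first.
  by move=> s _; rewrite /sign_twist -!scalemxAr linearZ /= val_submodJ ?inE.
rewrite -mulmx_sumr; apply/row_matrixP=> i; rewrite row_mul row0.
have /spechtP[W WE ->] : (row i (val_submod 1%:M) <= U)%MS.
  by apply: submx_trans (row_sub _ _) (val_submodP _).
by rewrite -gring_row_mul YW0 // raddf0.
Qed.

Definition sign_sum b B : 'M[algC]_N := \sum_(s in symOn B) sgnV b s *: aG s.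

Lemma sign_sumMl b B t : t \in symOn B -> aG t *m sign_sum b B = sgnV b t *: sign_sum b B.
Proof.
move=> tB; rewrite /sign_sum mulmx_sumr [in RHS](reindex_inj (mulgI t)) /= scaler_sumr.
apply: eq_big => [s|s _]; first by rewrite groupMl.
rewrite aGM -scalemxAr scalerA odd_permM -signr_addb; congr (_ ^+ _ *: _).
by case: b => //=; rewrite addbA addbb.
Qed.

Let tperm_symOn B i j : i \in B -> j \in B -> tperm i j \in symOn B.
Proof.
move=> iB jB; apply/symOnP=> x xB; rewrite tpermD //.
  by apply: contraNneq xB => <-.
by apply: contraNneq xB => <-.
Qed.

Let eq_opp0 (Z : 'M[algC]_N) : Z = - Z -> Z = 0.
Proof.
move=> ZN; apply/eqP; have /eqP := ZN; rewrite -addr_eq0 -mulr2n -scaler_nat scaler_eq0.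
by rewrite pnatr_eq0.
Qed.

(** Two points of B come from the same column through g, and their transposition acts by 1 on the
    right factor and by -1 on the left factor. *)
Lemma col_sum_avg_eq0 B W : (head 0%N lambda < #|B|)%N -> (W \in E)%MS ->
  col_sum *m W *m sign_sum false B = 0.
Proof.
move=> cB /envelop_mxP[a ->]; have col_lt := tab_col_lt lambda.
have key g : col_sum *m aG g *m sign_sum false B = 0.
  have [i [j [iB jB ij cij]]] :=
    pigeonhole_lt (f := fun i => tab_col lambda (g^-1%g i)) (fun i => col_lt _) cB.
  set Z := _ *m _; apply: eq_opp0.
  rewrite {1}/Z -[sign_sum _ _](scale1r) -(sign_sumMl false (tperm_symOn iB jB)).
  rewrite mulmxA -[_ *m aG (tperm i j)]mulmxA -aGM.
  have -> : (g * tperm i j = tperm (g^-1 i) (g^-1 j) * g)%g.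
    by rewrite -tpermJ conjgE invgK mulgA mulgKV.
  rewrite aGM mulmxA (col_sumMr (tperm_col_stab cij)).
  by rewrite odd_tperm (inj_eq perm_inj) ij expr1 scaleN1r !mulNmx.
move: key; move: col_sum (sign_sum _ _) => c S key.
rewrite mulmx_sumr mulmx_suml big1 // => g _.
by rewrite -scalemxAr -scalemxAl key scaler0.
Qed.

(** As in col_sum_avg_eq0, with the two signs exchanged. *)
Lemma row_sum_avg_eq0 B W : (size lambda < #|B|)%N -> (W \in E)%MS ->
  row_sum *m W *m sign_sum true B = 0.
Proof.
move=> cB /envelop_mxP[a ->]; have row_lt := tab_row_lt lambda.
have key g : row_sum *m aG g *m sign_sum true B = 0.
  have [i [j [iB jB ij rij]]] :=
    pigeonhole_lt (f := fun i => tab_row lambda (g^-1%g i)) (fun i => row_lt _) cB.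
  set Z := _ *m _; apply: eq_opp0.
  have -> : - Z = row_sum *m aG g *m (aG (tperm i j) *m sign_sum true B).
    by rewrite (sign_sumMl true (tperm_symOn iB jB)) /= odd_tperm ij expr1 scaleN1r mulmxN.
  rewrite mulmxA -[_ *m aG (tperm i j)]mulmxA -aGM.
  have -> : (g * tperm i j = tperm (g^-1 i) (g^-1 j) * g)%g.
    by rewrite -tpermJ conjgE invgK mulgA mulgKV.
  by rewrite aGM [X in _ = X *m _]mulmxA (row_sumMr (tperm_row_stab rij)).
move: key; move: row_sum (sign_sum _ _) => c S key.
rewrite mulmx_sumr mulmx_suml big1 // => g _.
by rewrite -scalemxAr -scalemxAl key scaler0.
Qed.

(** The vector is a b a: it is nonzero because (a b)(a b)^* = |C| a b a. *)
Lemma avg_row_neq0 : avg_mx (twist_repr (specht_repr lambda) false)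
  [set i | tab_row lambda i == 0%N] != 0.
Proof.
have rE := row_sum_envelop; have cE := col_sum_envelop; have yE := young_envelop.
have YrE : (Y *m row_sum \in E)%MS by rewrite envelop_mxM.
apply: (avg_specht_neq0 (v := gring_row (Y *m row_sum))).
- apply: contra_neq young_neq0 => /(gring_row_eq0 YrE) Yr0; apply: mulmx_adj_eq0.
  rewrite adj_mxM adj_row_sum adj_col_sum mulmxA -(mulmxA row_sum) col_sum_sqr.
  by rewrite -scalemxAr -scalemxAl Yr0 scaler0.
- by apply/spechtP; exists row_sum.
move=> a aA; rewrite scale1r -gring_row_mul -[_ *m aG a]mulmxA row_sumMr //.
exact: (subsetP (symOn_row0 lambda)).
Qed.

Lemma avg_col_neq0 : avg_mx (twist_repr (specht_repr lambda) true)
  [set i | tab_col lambda i == 0%N] != 0.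
Proof.
have yE := young_envelop.
apply: (avg_specht_neq0 (v := gring_row Y)).
- by apply: contra_neq young_neq0 => /(gring_row_eq0 yE).
- by apply/spechtP; exists 1%:M; rewrite ?mulmx1 // envelop_mx1.
move=> a aA; rewrite -gring_row_mul -[_ *m aG a]mulmxA col_sumMr //; last first.
  exact: (subsetP (symOn_col0 lambda)).
by rewrite -scalemxAr linearZ.
Qed.

Lemma avg_row_eq0 B : (head 0%N lambda < #|B|)%N ->
  avg_mx (twist_repr (specht_repr lambda) false) B = 0.
Proof.
move=> cB; apply: avg_specht_eq0 => W WE; rewrite -/(sign_sum false B).
by rewrite -[Y *m W]mulmxA -[LHS]mulmxA col_sum_avg_eq0 ?mulmx0.
Qed.

(** Here the row sum is not next to the average, but V = a b W S satisfies b V = 0 by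
    row_sum_avg_eq0, and V^* V = |R| S^* W^* b V. *)
Lemma avg_col_eq0 B : (size lambda < #|B|)%N ->
  avg_mx (twist_repr (specht_repr lambda) true) B = 0.
Proof.
move=> cB; apply: avg_specht_eq0 => W WE; rewrite -/(sign_sum true B).
set V := _ *m _.
have cV : col_sum *m V = 0.
  have cWE : (col_sum *m W \in E)%MS by rewrite envelop_mxM ?col_sum_envelop.
  have -> : V = row_sum *m (col_sum *m W) *m sign_sum true B by rewrite /V !mulmxA.
  by rewrite row_sum_avg_eq0 ?mulmx0.
suffices V0 : adj_mx V = 0 by rewrite -[V]adj_mxK V0 /adj_mx trmx0 raddf0.
have rV : row_sum *m V = #|R|%:R *: V.
  rewrite /V /Y; have := row_sum_sqr; move: row_sum col_sum (sign_sum _ _) => r c S rr.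
  by rewrite !mulmxA rr -!scalemxAl.
apply: mulmx_adj_eq0; rewrite adj_mxK.
have -> : adj_mx V = adj_mx (W *m sign_sum true B) *m (col_sum *m row_sum).
  by rewrite /V /Y !adj_mxM adj_row_sum adj_col_sum [LHS]mulmxA.
by rewrite -mulmxA -[X in _ *m X]mulmxA rV -scalemxAr cV scaler0 mulmx0.
Qed.

End Specht.

(** The trivial character corresponds to the first row and the sign character to the first column;
    the twist is chosen according to which of them realizes the level. *)
Lemma exists_level_twist n (lambda : intpart n) :
  exists m (rG : mx_representation algC 'Sym_('I_n) m),
  [/\ mx_irreducible rG, forall s, `|cfRepr rG s| = `|chi lambda s|,
      chi lambda 1%g = m%:R,
      exists2 A : {set 'I_n}, #|A| = (n - level lambda)%N & avg_mx rG A != 0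
    & forall B : {set 'I_n}, #|B| = (n - level lambda).+1 -> avg_mx rG B = 0].
Proof.
have le_n (A : {set 'I_n}) : (#|A| <= n)%N by rewrite -[X in (_ <= X)%N]card_ord max_card.
have cr := card_tab_row lambda 0; have cc := card_tab_col0 lambda; rewrite nth0 in cr.
exists (\rank (specht lambda)).
exists (twist_repr (specht_repr lambda) (n - size lambda < n - head 0 lambda)%N).
split; first by apply: twist_irr; apply: specht_irr.
- by move=> s; rewrite norm_cfRepr_twist.
- exact: cfRepr1.
- rewrite /level; case: ltnP => [lt|le].
    exists [set i | tab_col lambda i == 0%N]; last exact: avg_col_neq0.
    by rewrite cc subKn // -cc.
  exists [set i | tab_row lambda i == 0%N]; last exact: avg_row_neq0.
  by rewrite cr subKn // -cr.
move=> B; rewrite /level; case: ltnP => [lt|le].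
  by rewrite subKn -?cc // => cB; apply: avg_col_eq0; rewrite cB -cc.
by rewrite subKn -?cr // => cB; apply: avg_row_eq0; rewrite cB -cr.
Qed.

(** * The Kronecker coefficient *)

Lemma expn_prod c d : (c ^ d = \prod_(i < d) c)%N.
Proof. by rewrite prod_nat_const card_ord. Qed.

Lemma expn_le_bin n d : (d <= n)%N -> (n ^ d <= d ^ d * 'C(n, d))%N.
Proof.
move=> dn; rewrite -(leq_pmul2r (fact_gt0 d)) -mulnA bin_ffact -ffactnn !ffact_prod.
rewrite (expn_prod n) (expn_prod d d) -!big_split /=.
apply: leq_prod => i _; rewrite !mulnBr mulnC leq_sub2l // leq_mul2r dn orbT.
by [].
Qed.

Lemma bin_le_exp2 n d : ('C(n, d) <= 2 ^ n)%N.
Proof.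
have := cards_draws [set: 'I_n] d; rewrite cardsT card_ord => <-.
have := card_powerset [set: 'I_n]; rewrite cardsT card_ord => <-.
by apply: subset_leq_card; apply/subsetP=> B; rewrite !inE => /andP[].
Qed.

Lemma expnn_le_fact d : (d ^ d <= 4 ^ d * d`!)%N.
Proof.
apply: (@leq_trans (d.*2 ^_ d)).
  rewrite ffact_prod expn_prod; apply: leq_prod => i _.
  by rewrite -addnn -addnBA ?leq_addr // ltnW.
rewrite -bin_ffact leq_mul2r (leq_trans (bin_le_exp2 _ _)) ?orbT //.
by rewrite -mul2n expnM.
Qed.

Lemma level_le n (lambda : intpart n) : (level lambda <= n)%N.
Proof. by rewrite /level geq_min leq_subr. Qed.

Section Level.
Variables (n : nat) (lambda : intpart n).
Let d := level lambda.

(** With v = d^d chi(1) / n^d, the middle term of the theorem is the square root of a power of 2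
    times the product of the values of v for the two partitions. *)
Lemma level_constituent : (0 < d)%N ->
  let v : algC := d%:R ^+ d * chi lambda 1%g / n%:R ^+ d in
  exists (T : {set 'I_n}) (theta : 'CF(stab T)) (phi : 'CF('Sym_('I_n))),
  [/\ #|T| = d, theta \in irr (stab T) & symOn (~: T) \subset cfker theta] /\
  [/\ phi \is a character, forall s, `|phi s| = `|chi lambda s|,
      exists2 c, c \is a character & 'Ind['Sym_('I_n)] theta = phi + c,
      theta 1%g <= 2%:R ^+ d * v & v ^+ 2 <= 4%:R ^+ d * d%:R ^+ d].
Proof.
move=> d_gt0 v; have dn : (d <= n)%N := level_le lambda.
have [m [rG [irrG phi_chi chi1 [A cA avgA] avgB]]] := exists_level_twist lambda.
pose T := ~: A; have cT : #|T| = d by rewrite cardsCs setCK cA card_ord subKn.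
have nzT : avg_mx rG (~: T) != 0 by rewrite setCK.
have [theta [irrth kerth th1 indth]] := exists_fixed_constituent irrG nzT.
exists T, theta, (cfRepr rG); split=> //.
have avg0 (B : {set 'I_n}) : #|B| = #|~: T|.+1 -> avg_mx rG B = 0 by rewrite setCK cA; apply: avgB.
have low := degree_lower_bound avg0 irrG; rewrite cT card_ord in low.
set w := \rank _ in low th1.
have n_gt0 : 0 < n%:R :> algC by rewrite ltr0n (leq_trans d_gt0).
have nd_gt0 : 0 < n%:R ^+ d :> algC by rewrite exprn_gt0.
split; [exact: cfRepr_char | by [] | by [] | |].
  apply: le_trans th1 _; rewrite /v mulrA ler_pdivlMr // mulrA chi1 -!natrX -!natrM ler_nat.
  apply: leq_trans (leq_mul (leqnn w) (expn_le_bin dn)) _.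
  rewrite mulnCA [X in (_ <= X)%N]mulnAC [X in (_ <= X)%N]mulnC leq_mul2l [(w * _)%N]mulnC.
  by rewrite low orbT.
have th_ge0 : 0 <= theta 1%g by have /irrP[i ->] := irrth; apply: ltW (irr1_gt0 i).
have upp : (m * d`!)%:R <= n%:R ^+ d * theta 1%g.
  have [c chc /(congr1 (fun f : 'CF(_) => f 1%g))] := indth.
  rewrite cfInd1 ?subsetT // index_stab cT card_ord cfunE cfRepr1 => eqI.
  have le_m : m%:R <= ('C(n, d))%:R * theta 1%g by rewrite eqI lerDl char1_ge0.
  rewrite natrM; apply: le_trans (ler_wpM2r (ler0n _ _) le_m) _.
  rewrite mulrAC -natrM bin_ffact -natrX ler_wpM2r // ler_nat.
  rewrite ffact_prod expn_prod; apply: leq_prod => i _.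
  exact: leq_subr.
have th_sqr := degree_sqr_le irrth kerth; rewrite cT in th_sqr.
have f_gt0 : 0 < (d`!)%:R :> algC by rewrite ltr0n fact_gt0.
have m_sqr : m%:R ^+ 2 * (d`!)%:R <= (n%:R ^+ d) ^+ 2 :> algC.
  rewrite -(ler_pM2r f_gt0) -mulrA -expr2 -exprMn -natrM.
  apply: (@le_trans _ _ ((n%:R ^+ d * theta 1%g) ^+ 2)).
    by rewrite lerXn2r ?nnegrE ?ler0n ?mulr_ge0 // ltW.
  by rewrite exprMn ler_wpM2l // exprn_ge0 // ltW.
rewrite /v exprMn exprVn ler_pdivrMr ?exprn_gt0 // exprMn chi1.
have dd : d%:R ^+ d <= 4%:R ^+ d * (d`!)%:R :> algC by rewrite -!natrX -natrM ler_nat expnn_le_fact.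
have c_ge0 : 0 <= 4%:R ^+ d :> algC by rewrite exprn_ge0.
have a_ge0 : 0 <= d%:R ^+ d :> algC by rewrite exprn_ge0.
move: (d%:R ^+ d) (4%:R ^+ d) a_ge0 c_ge0 dd => a c a_ge0 c_ge0 dd.
have -> : a ^+ 2 * m%:R ^+ 2 = a * (a * m%:R ^+ 2) by ring.
rewrite [c * a]mulrC -mulrA ler_wpM2l //.
apply: le_trans (ler_wpM2r (_ : 0 <= m%:R ^+ 2) dd) _; first by rewrite exprn_ge0.
by rewrite -mulrA ler_wpM2l // mulrC.
Qed.

End Level.

Lemma kronecker_cfdot n (lambda mu nu : intpart n) :
  kronecker lambda mu nu = '[chi lambda * chi mu, (chi nu)^*%CF].
Proof.
rewrite cfdotE /kronecker -(card_Sn n) -cardsT; congr (_ * _).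
apply: eq_big => [s|s _]; first by rewrite inE.
by rewrite cfConjCE conjCK [(chi lambda * chi mu) s]cfunE.
Qed.

Lemma kronecker_ge0 n (lambda mu nu : intpart n) : 0 <= kronecker lambda mu nu.
Proof.
rewrite kronecker_cfdot natr_ge0 // Cnat_cfdot_char ?rpredM ?cfConjC_char //; exact: cfRepr_char.
Qed.

Lemma kronecker_sqr_le n (lambda mu nu : intpart n) :
  kronecker lambda mu nu ^+ 2 <= '[chi lambda * chi mu].
Proof.
rewrite -{1}(ger0_norm (kronecker_ge0 lambda mu nu)) kronecker_cfdot.
apply: le_trans (cfCauchySchwarz _ _).1 _.
have /irrP[i ->] := chi_irr nu.
by rewrite cfdot_conjC cfnorm_irr conjC1 mulr1.
Qed.

Theorem corollary2p3 :
  exists C Cbar : algC, [/\ 0 < C, 0 < Cbar &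
    forall (n d1 d2 : nat) (lambda mu nu : intpart n),
      (0 < d1)%N -> (d1 <= d2)%N ->
      level lambda = d1 -> level mu = d2 ->
      kronecker lambda mu nu
        <= sqrtC (C ^+ d2 * d1%:R ^+ d1 * d2%:R ^+ d2 / n%:R ^+ (d1 + d2)
                  * chi lambda 1%g * chi mu 1%g)
        <= Cbar ^+ d2 * 4.-root d1%:R ^+ d1 * 4.-root d2%:R ^+ d2].
Proof.
exists (2%:R ^+ 11), (2%:R ^+ 7); split; rewrite ?exprn_gt0 ?ltr0n //.
move=> n d1 d2 lambda mu nu d1_gt0 d12 l1 l2; have d2_gt0 := leq_trans d1_gt0 d12.
have [] := @level_constituent n lambda; first by rewrite l1.
rewrite l1 => T1 [th1 [phi1 [[cT1 irr1 ker1] [ch1 eq1 ind1 low1 upp1]]]].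
have [] := @level_constituent n mu; first by rewrite l2.
rewrite l2 => T2 [th2 [phi2 [[cT2 irr2 ker2] [ch2 eq2 ind2 low2 upp2]]]].
set v1 := _ / _ in low1 upp1; set v2 := _ / _ in low2 upp2.
set Q := _ * chi mu 1%g.
have defQ : Q = (2%:R ^+ 11) ^+ d2 * (v1 * v2).
  rewrite /Q /v1 /v2 exprD invfM; move: (n%:R ^+ d1)^-1 (n%:R ^+ d2)^-1 => a b; ring.
have v_ge0 (lam : intpart n) d : 0 <= d%:R ^+ d * chi lam 1%g / n%:R ^+ d.
  by rewrite divr_ge0 ?mulr_ge0 ?exprn_ge0 // char1_ge0 ?cfRepr_char.
have v1_ge0 : 0 <= v1 by apply: v_ge0.
have v2_ge0 : 0 <= v2 by apply: v_ge0.
clearbody Q v1 v2; have Q_ge0 : 0 <= Q.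
  by rewrite defQ; apply: mulr_ge0; [rewrite !exprn_ge0 | apply: mulr_ge0].
have th_ge0 T (th : 'CF(stab T)) : th \in irr _ -> 0 <= th 1%g.
  by case/irrP=> i ->; apply: ltW (irr1_gt0 i).
have norm_eq : '[chi lambda * chi mu] = '[phi1 * phi2].
  rewrite !(cfnormE (cfun_onG _)); congr (_ * _); apply: eq_bigr => s _.
  by rewrite [(chi lambda * chi mu) s]cfunE [(phi1 * phi2) s]cfunE !normrM eq1 eq2.
apply/andP; split.
  rewrite -[leLHS]sqrCK ?kronecker_ge0 // ler_sqrtC ?nnegrE ?exprn_ge0 ?kronecker_ge0 //.
  apply: le_trans (kronecker_sqr_le _ _ _) _; rewrite norm_eq.
  have := @cfnorm_mul_le _ d2 T1 T2 th1 th2 phi1 phi2.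
  rewrite cT1 cT2 => /(_ d12 (leqnn _) irr1 irr2 ker1 ker2 ch1 ch2 ind1 ind2) /le_trans; apply.
  apply: (@le_trans _ _ ((2%:R ^+ d1 * v1) * (2%:R ^+ d2 * v2) * (2 ^ (9 * d2))%:R)).
    by rewrite ler_wpM2r ?ler0n // ler_pM ?th_ge0.
  rewrite defQ natrX (_ : _ * _ * _ = 2%:R ^+ d1 * 2%:R ^+ d2 * 2%:R ^+ (9 * d2) * (v1 * v2));
    last by ring.
  apply: ler_wpM2r; first exact: mulr_ge0.
  rewrite -!exprD -exprM.
  by apply: ler_weXn2l; [rewrite ler1n | clear -d12; lia].
rewrite -(@ler_pXn2r _ 4) ?nnegrE ?sqrtC_ge0 ?mulr_ge0 ?exprn_ge0 ?rootC_ge0 ?ler0n //.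
rewrite (exprM _ 2 2) sqrtCK defQ.
have rootE d : (4.-root d%:R ^+ d) ^+ 4 = d%:R ^+ d :> algC.
  by rewrite -exprM mulnC exprM rootCK.
have mul3X (a b c : algC) k : (a * b * c) ^+ k = a ^+ k * (b ^+ k * c ^+ k).
  by rewrite -mulrA !exprMn.
have powX a k l : ((2%:R ^+ a) ^+ k) ^+ l = 2%:R ^+ (a * l * k) :> algC.
  by rewrite -!exprM; congr (_ ^+ _); ring.
rewrite [leRHS]mul3X !rootE mulrA [leLHS]mul3X !powX.
apply: (@le_trans _ _ (2%:R ^+ (11 * 2 * d2) *
  ((4%:R ^+ d1 * d1%:R ^+ d1) * (4%:R ^+ d2 * d2%:R ^+ d2)))).
  by rewrite ler_wpM2l ?exprn_ge0 // ler_pM ?exprn_ge0.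
have -> (a b c d e : algC) : a * ((b * c) * (d * e)) = (a * b * d) * (c * e) by ring.
apply: ler_wpM2r.
  by rewrite -!natrX -natrM ler0n.
have -> : 4%:R = 2%:R ^+ 2 :> algC by rewrite -[4%N]/(2 ^ 2)%N natrX.
by rewrite -!exprM -!exprD; apply: ler_weXn2l; [rewrite ler1n | clear -d12; lia].
Qed.
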